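(* Let $\mathcal{A}$ be a unital real $C^*$-algebra, $\mathcal{H}$ a finite-dimensional real Hilbert space, and $\Phi\in\mathrm{UCP}_{C^*-ext}(\mathcal{A},\mathscr{B}(\mathcal{H}))$. Then there exist finitely many closed subspaces $\mathcal{H}_i\subseteq\mathcal{H}$ and maps $\Phi_i\in\mathrm{UCP}(\mathcal{A},\mathscr{B}(\mathcal{H}_i))$, $1\le i\le k$, such that (i) $\Phi_i$ is pure for each $1\le i\le k$, and (ii) $\mathcal{H}=\bigoplus_i\mathcal{H}_i$ (orthogonal direct sum) and $\Phi\sim\bigoplus_i\Phi_i$. That is, $\Phi$ is unitarily equivalent to a direct sum of pure UCP maps.
   Context: All linear maps are real linear. A real $C^*$-algebra is a real Banach $*$-algebra with $\|a^*a\|=\|a\|^2$ and $1+a^*a$ invertible in the unitization for all $a$. An element is positive if it is of the form $b^*b$. For a real Hilbert space $\mathcal{H}$, $\mathscr{B}(\mathcal{H})$ is the algebra of bounded real linear operators. A real linear $\Phi:\mathcal{A}\to\mathscr{B}(\mathcal{H})$ is completely positive (CP) if $\sum_{i,j=1}^nT_i^*\Phi(a_i^*a_j)T_j\ge0$ for all finite families $a_j\in\mathcal{A}$, $T_j\in\mathscr{B}(\mathcal{H})$. $\mathrm{UCP}(\mathcal{A},\mathscr{B}(\mathcal{H}))$ is the set of CP maps with $\Phi(1)=I$. $\mathrm{Ad}_T(X)=T^*XT$. $\Phi\sim\Psi$ means $\Psi=\mathrm{Ad}_U\circ\Phi$ for some unitary $U$. $\Phi\in\mathrm{UCP}(\mathcal{A},\mathscr{B}(\mathcal{H}))$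 is a $C^*$-extreme point (written $\Phi\in\mathrm{UCP}_{C^*-ext}(\mathcal{A},\mathscr{B}(\mathcal{H}))$) if whenever $\Phi=\sum_{j=1}^n\mathrm{Ad}_{T_j}\circ\Phi_j$ with $\Phi_j\in\mathrm{UCP}(\mathcal{A},\mathscr{B}(\mathcal{H}))$ and invertible $T_j\in\mathscr{B}(\mathcal{H})$ satisfying $\sum_jT_j^*T_j=I$, then $\Phi_j\sim\Phi$ for all $j$. A CP map $\Phi:\mathcal{A}\to\mathscr{B}(\mathcal{H})$ is pure if every CP map $\Psi:\mathcal{A}\to\mathscr{B}(\mathcal{H})$ for which $\Phi-\Psi$ is CP is of the form $\Psi=t\Phi$ with $t\in[0,1]$. Direct sums of maps are defined by $(\bigoplus_i\Phi_i)(a)=\bigoplus_i\Phi_i(a)$.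
   Formalization: ''Completely positive'' here also requires Φ(a* )=Φ(a)* for all a; this is automatic if dim H ≥ 2. Without it the claim fails on one-dimensional summands, e.g. for Φ(a,b,z)=diag(a,b) on R⊕R⊕C. *)

(* Defs.v *)
From HB Require Import structures.
From mathcomp Require Import all_boot all_order all_algebra.
From mathcomp Require Import boolp classical_sets reals.
From mathcomp Require Import lra.

Set Implicit Arguments.
Unset Strict Implicit.
Unset Printing Implicit Defensive.

Import Order.TTheory GRing.Theory Num.Theory.

Local Open Scope ring_scope.

(* The norm is a field of the structure because [algType] and [normedModType]
   have no common extension in the hierarchy.  The algebra is unital (in an
   [algType], [1 != 0]), so it is its own unitization in the last axiom. *)
HB.mixin Record isRealCStarAlgebra (R : realType) A of GRing.Algebra R A := {
  cnorm : A -> R;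
  cnorm_eq0 : forall a, cnorm a = 0 -> a = 0;
  cnormD : forall a b, cnorm (a + b) <= cnorm a + cnorm b;
  cnormZ : forall (t : R) a, cnorm (t *: a) = `|t| * cnorm a;
  cnormM : forall a b, cnorm (a * b) <= cnorm a * cnorm b;
  cnorm_complete : forall u : nat -> A,
    (forall e, 0 < e -> exists N, forall m n,
       (N <= m)%N -> (N <= n)%N -> cnorm (u m - u n) < e) ->
    exists l, forall e, 0 < e -> exists N, forall n,
       (N <= n)%N -> cnorm (u n - l) < e;
  star : A -> A;
  starD : forall a b, star (a + b) = star a + star b;
  starZ : forall (t : R) a, star (t *: a) = t *: star a;
  starM : forall a b, star (a * b) = star b * star a;
  starK : forall a, star (star a) = a;
  cnorm_star : forall a, cnorm (star a * a) = cnorm a ^+ 2;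
  one_add_star_inv : forall a, exists b,
    b * (1 + star a * a) = 1 /\ (1 + star a * a) * b = 1
}.

#[short(type="realCStarAlgType")]
HB.structure Definition RealCStarAlgebra (R : realType) :=
  {A of GRing.Algebra R A & isRealCStarAlgebra R A}.

(* A finite-dimensional inner product space over [R] is complete, its linear
   subspaces are closed and its linear endomorphisms are bounded, so [ 'End(H) ]
   is the algebra of bounded operators on [H] and [ {vspace H} ] is the set of
   its closed subspaces. *)
HB.mixin Record hasInner (R : realType) H of Vector R H := {
  inner : {dot H for @idfun R}
}.

#[short(type="finHilbertType")]
HB.structure Definition FinHilbert (R : realType) :=
  {H of Vector R H & hasInner R H}.

Section InnerTheory.
Variables (R : realType) (H : finHilbertType R).
Implicit Types x y z : H.

Lemma innerC x y : inner x y = inner y x.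
Proof. by rewrite hermitian_subproof expr0 mul1r. Qed.

Lemma inner_gt0 x : x != 0 -> 0 < inner x x.
Proof. exact: neq0_dnorm_gt0. Qed.

Lemma innerDr x y z : inner x (y + z) = inner x y + inner x z.
Proof. exact: linearDr. Qed.

Lemma innerZr (t : R) x y : inner x (t *: y) = t * inner x y.
Proof. exact: linearZr_LR. Qed.

Lemma innerDl x y z : inner (x + y) z = inner x z + inner y z.
Proof. by rewrite innerC innerDr !(innerC z). Qed.

Lemma innerZl (t : R) x y : inner (t *: x) y = t * inner x y.
Proof. by rewrite innerC innerZr (innerC y). Qed.

Lemma inner0r x : inner x 0 = 0.
Proof. by rewrite -(scale0r x) innerZr mul0r. Qed.

Lemma innerBr x y z : inner x (y - z) = inner x y - inner x z.
Proof. by rewrite innerDr -scaleN1r innerZr mulN1r. Qed.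

Lemma inner_eq0 x : inner x x = 0 -> x = 0.
Proof.
by move=> xx0; apply: contra_eq xx0 => /inner_gt0; rewrite lt_def => /andP[].
Qed.

Lemma inner_injr y z : (forall x, inner x y = inner x z) -> y = z.
Proof.
by move=> yz; apply/subr0_eq/inner_eq0; rewrite innerBr yz subrr.
Qed.

Lemma inner_sumr I (r : seq I) (F : I -> H) x :
  inner x (\sum_(i <- r) F i) = \sum_(i <- r) inner x (F i).
Proof.
elim: r => [|i r IHr]; first by rewrite !big_nil inner0r.
by rewrite !big_cons innerDr IHr.
Qed.

Lemma inner_suml I (r : seq I) (F : I -> H) x :
  inner (\sum_(i <- r) F i) x = \sum_(i <- r) inner (F i) x.
Proof. by rewrite innerC inner_sumr; apply: eq_bigr => i _; rewrite innerC. Qed.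

End InnerTheory.

Section SubHilbert.
Variables (R : realType) (H : finHilbertType R) (U : {vspace H}).

Definition sub_inner (x y : subvs_of U) : R := inner (vsval x) (vsval y).

Fact sub_inner_bilinear : bilinear_for *%R (@idfun R \; *%R) sub_inner.
Proof.
split=> [y t x x' | x t y y']; rewrite /sub_inner /=.
  by rewrite innerDl innerZl.
by rewrite innerDr innerZr.
Qed.

HB.instance Definition _ := bilinear_isBilinear.Build R _ _ _ _ _ sub_inner
  sub_inner_bilinear.

Fact sub_inner_hermitian x y :
  sub_inner x y = (-1) ^+ false * idfun (sub_inner y x).
Proof. by rewrite expr0 mul1r; apply: innerC. Qed.

HB.instance Definition _ := isHermitianSesquilinear.Build R _ false idfun
  sub_inner sub_inner_hermitian.

Fact sub_inner_gt0 x : x != 0 -> 0 < sub_inner x x.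
Proof. by move=> x0; apply: inner_gt0; rewrite -(inj_eq val_inj) in x0. Qed.

HB.instance Definition _ := isDotProduct.Build R _ sub_inner sub_inner_gt0.

HB.instance Definition _ := hasInner.Build R (subvs_of U) sub_inner.

End SubHilbert.

Section Adjoint.
Variables (R : realType) (H K : finHilbertType R).
Implicit Type f : 'Hom(H, K).

Definition adj f : 'Hom(K, H) :=
  xget 0 [set g : 'Hom(K, H) | forall x y, inner (f x) y = inner x (g y)]%classic.

Let X := vbasis {:H}.

Let gram (L : finHilbertType R) (h : 'Hom(H, L)) (y : L) :
  'rV[R]_(\dim {:H}) := \row_i inner (h X`_i) y.

Let gram_is_linear (L : finHilbertType R) (h : 'Hom(H, L)) : linear (@gram L h).
Proof. by move=> t y z; apply/rowP => i; rewrite !mxE innerDr innerZr. Qed.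

Let gram_lin (L : finHilbertType R) (h : 'Hom(H, L)) :
    {linear L -> 'rV[R]_(\dim {:H})} :=
  HB.pack (@gram L h) (GRing.isLinear.Build R _ _ _ _ (@gram_is_linear L h)).

Lemma adjP f x y : inner (f x) y = inner x (adj f y).
Proof.
have basisP (L : finHilbertType R) (h : 'Hom(H, L)) z w :
    gram h z = gram \1%VF w -> forall u, inner (h u) z = inner u w.
  move=> /rowP eqzw u; rewrite (coord_vbasis (memvf u)) linear_sum !inner_suml.
  apply: eq_bigr => i _; rewrite linearZ /= !innerZl.
  by have := eqzw i; rewrite !mxE id_lfunE => ->.
pose G : 'Hom(H, 'rV[R]_(\dim {:H})) := linfun (gram_lin \1%VF).
have kerG : lker G == 0%VS.
  apply/lker0P => z w; rewrite !lfunE /= => /basisP eqzw.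
  by apply: inner_injr => u; rewrite -eqzw id_lfunE.
have imG : limg G = fullv.
  apply/eqP; rewrite eqEdim subvf /= limg_dim_eq ?(eqP kerG) ?capv0 //.
  by rewrite dimvf /dim /= mul1n.
have [g gP] : exists g : 'Hom(K, H), forall x y, inner (f x) y = inner x (g y).
  exists (G^-1 \o linfun (gram_lin f))%VF => u v; apply: basisP.
  rewrite comp_lfunE; set w := linfun _ v.
  have : G (G^-1 w)%VF = w by apply: limg_lfunVK; rewrite imG memvf.
  by rewrite [LHS]lfunE [RHS]lfunE.
rewrite /adj; case: xgetP => [h -> hP | noadj]; first exact: hP.
by have := noadj g gP.
Qed.

Lemma adj_unique f (g : 'Hom(K, H)) :
  (forall x y, inner (f x) y = inner x (g y)) -> g = adj f.
Proof.
by move=> gP; apply/lfunP => y; apply: inner_injr => x; rewrite -gP adjP.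
Qed.

End Adjoint.

Section Operators.
Variables (R : realType) (H : finHilbertType R).
Implicit Types (S T U X : 'End(H)).

Definition Ad T X : 'End(H) := (adj T \o X \o T)%VF.

Definition positive_op X := exists S, X = (adj S \o S)%VF.

Definition invertible_op T := exists S, (S \o T = \1 /\ T \o S = \1)%VF.

Definition unitary_op U := (adj U \o U = \1 /\ U \o adj U = \1)%VF.

End Operators.

Section CPMaps.
Variables (R : realType) (A : realCStarAlgType R).

Definition cp_sums (H : finHilbertType R) (Phi : {linear A -> 'End(H)}) :=
  forall n (a : 'I_n -> A) (T : 'I_n -> 'End(H)),
    positive_op
      (\sum_(i < n) \sum_(j < n) (adj (T i) \o Phi (star (a i) * a j)%R \o T j)%VF).

(* Complete positivity, i.e. positivity of all the operator matrices
   [Phi (a_i^* a_j)], makes [Phi] hermitian.  This follows from [cp_sums] when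
   [1 < \dim H] (lemma [cp_sums_hermitian]).  When [\dim H = 1], [cp_sums] alone
   only says [0 <= Phi (c^* c)], which does not see the values of [Phi] on skew
   elements, so the condition has to be stated. *)
Definition completely_positive (H : finHilbertType R)
    (Phi : {linear A -> 'End(H)}) :=
  (forall a, Phi (star a) = adj (Phi a)) /\ cp_sums Phi.

Definition UCP (H : finHilbertType R) (Phi : {linear A -> 'End(H)}) :=
  completely_positive Phi /\ Phi 1 = \1%VF.

Definition pure (H : finHilbertType R) (Phi : {linear A -> 'End(H)}) :=
  completely_positive Phi /\
  forall Psi : {linear A -> 'End(H)},
    completely_positive Psi -> completely_positive (Phi \- Psi) ->
    exists t : R, 0 <= t <= 1 /\ forall a, Psi a = t *: Phi a.

Definition unitarily_equivalent (H : finHilbertType R) (Phi Psi : A -> 'End(H)) :=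
  exists U : 'End(H), unitary_op U /\ forall a, Psi a = Ad U (Phi a).

Definition cstar_extreme (H : finHilbertType R) (Phi : {linear A -> 'End(H)}) :=
  UCP Phi /\
  forall n (Phis : 'I_n -> {linear A -> 'End(H)}) (T : 'I_n -> 'End(H)),
    (forall j, UCP (Phis j)) ->
    (forall j, invertible_op (T j)) ->
    \sum_(j < n) (adj (T j) \o T j)%VF = \1%VF ->
    (forall a, Phi a = \sum_(j < n) Ad (T j) (Phis j a)) ->
    forall j, unitarily_equivalent (Phis j) Phi.

Section DirectSum.
Variables (H : finHilbertType R) (k : nat) (Hs : 'I_k -> {vspace H}).

Definition orthogonal_decomposition :=
  (forall i j, i != j ->
     forall x y, x \in Hs i -> y \in Hs j -> inner x y = 0) /\
  (\sum_(i < k) Hs i)%VS = fullv.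

Definition incl (i : 'I_k) : 'Hom(subvs_of (Hs i), H) := linfun vsval.

(* The adjoint of [incl i] is the orthogonal projection onto [Hs i]. *)
Definition direct_sum (Phis : forall i, {linear A -> 'End(subvs_of (Hs i))})
    (a : A) : 'End(H) :=
  \sum_(i < k) (incl i \o Phis i a \o adj (incl i))%VF.

Lemma direct_sumE Phis a i (x : subvs_of (Hs i)) :
  orthogonal_decomposition ->
  direct_sum Phis a (vsval x) = vsval (Phis i a x).
Proof.
case=> ortho _; rewrite /direct_sum sum_lfunE (bigD1 i) //= big1 ?addr0.
  rewrite !comp_lfunE lfunE /=; congr (vsval (Phis i a _)).
  by apply: inner_injr => y; rewrite -adjP lfunE.
move=> j ji; rewrite !comp_lfunE.
suff -> : adj (incl j) (vsval x) = 0 by rewrite !linear0.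
apply: inner_injr => y; rewrite -adjP lfunE inner0r.
by apply: (ortho j i ji); apply: subvsP.
Qed.

End DirectSum.

Lemma cp_sums_hermitian (H : finHilbertType R) (Phi : {linear A -> 'End(H)}) :
  (1 < \dim {:H})%N -> cp_sums Phi -> forall a, Phi (star a) = adj (Phi a).
Proof.
move=> dimH cpPhi a.
have star1 : star (1 : A) = 1.
  by have := starM (star 1 : A) 1; rewrite !(mulr1, starK).
have posC (X : 'End(H)) u v : positive_op X -> inner (X u) v = inner u (X v).
  by case=> S ->; rewrite !comp_lfunE -adjP innerC -adjP innerC.
have diagC b (T : 'End(H)) u v :
    inner ((adj T \o Phi (star b * b)%R \o T)%VF u) v
    = inner u ((adj T \o Phi (star b * b)%R \o T)%VF v).
  apply: posC; have := cpPhi 1%N (fun=> b) (fun=> T).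
  by rewrite !big_ord1.
have crossC (T : 'End(H)) u v :
    inner (Phi a u) (T v) + inner (Phi (star a) (T u)) v
    = inner (T u) (Phi a v) + inner u (Phi (star a) (T v)).
  have := @posC _ u v (cpPhi 2%N (fun i => if i == 0 then 1 else a)
                                (fun i => if i == 0 then T else \1%VF)).
  rewrite !big_ord_recl !big_ord0 /= !addr0 !(add_lfunE, innerDl, innerDr).
  have := diagC 1 T u v; have := diagC a \1%VF u v.
  rewrite !(comp_lfunE, id_lfunE) star1 !mul1r !mulr1 -!adjP.
  rewrite ![inner (adj _ _) _]innerC -!adjP.
  rewrite !id_lfunE [inner (Phi a u) _]innerC.
  rewrite [inner (Phi (star a) (T u)) v]innerC; lra.
pose D u := Phi a u - adj (Phi (star a)) u.
have DT (T : 'End(H)) u v : inner (D u) (T v) = inner (T u) (D v).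
  rewrite /D [LHS]innerC !innerBr -!adjP; have := crossC T u v.
  rewrite [inner (Phi a u) _]innerC [inner u _]innerC; lra.
have D0 u : D u = 0.
  have [-> | u0] := eqVneq u 0; first by rewrite /D !linear0 addr0.
  have [v uv] : exists v : H, v \notin <[u]>%VS.
    apply: contrapT => uH; move: dimH; rewrite ltnNge => /negP; apply.
    apply: (@leq_trans (\dim <[u]>)); last by rewrite dim_vline leq_b1.
    by apply: dimvS; apply/subvP => x _; apply: contrapT => /negP; eauto.
  pose w := inner u u *: v - inner u v *: u.
  have wu : inner w u = 0.
    by rewrite innerC innerBr !innerZr mulrC subrr.
  have w0 : w != 0.
    apply: contraNneq uv => /subr0_eq uvE; apply/vlineP.
    exists ((inner u u)^-1 * inner u v).
    by rewrite -scalerA -uvE scalerA mulVf ?scale1r ?gt_eqF ?inner_gt0.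
  pose f (x : H) : H := inner w x *: D u.
  have f_lin : linear f.
    by move=> t x y; rewrite /f innerDr innerZr scalerDl scalerA.
  pose T : 'End(H) :=
    linfun (HB.pack f (GRing.isLinear.Build R _ _ _ f f_lin) : {linear H -> H}).
  have := DT T u w; rewrite !lfunE /= /f wu scale0r innerZr.
  rewrite [inner 0 _]innerC inner0r => /eqP.
  by rewrite mulf_eq0 gt_eqF ?inner_gt0 //= => /eqP/inner_eq0.
apply: adj_unique => x y.
have /subr0_eq -> := D0 x.
by rewrite innerC -adjP innerC.
Qed.

End CPMaps.

(* Main.v *)
(** Write [q_f(h) = sum_ij <h_i, f(a_i^* a_j) h_j>] for the form whose positivity
    is complete positivity of [f].  If [Phi] is C*-extreme, every CP map [Psi]
    whose form is comparable with that of [Phi] in both directions is congruent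
    to it: [Psi = Z^* Phi Z] with [Z] invertible.  The unitary equivalence behind
    this property passes to compressions to invariant subspaces, because a
    unitary intertwining direct sums with a common summand yields, by feeding
    its component in this summand back as input, a unitary intertwining the
    other summands.  As [H] is an orthogonal sum of minimal invariant subspaces,
    [Phi] may be assumed irreducible.

    The operators [V] with [V^* Phi V <= c Phi] for some [c] form an algebra.  An
    idempotent [P] in it is similar, through the root [Z] of
    [P^* Phi P + (1 - P)^* Phi (1 - P)], to an orthogonal projection commuting
    with [Phi], so it is trivial.  Hence the singular elements of this
    finite-dimensional algebra kill a common vector [x <> 0].  If
    [0 <= Psi <= Phi], subtract from [Psi] and from [Phi - Psi] the largest
    possible multiples [t Phi] and [s Phi]; the remainders are [Z_1^* Phi Z_1]
    and [Z_2^* Phi Z_2] with [Z_1] and [Z_2] singular, and evaluating at [1] and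
    [x] gives [t + s = 1].  So the remainders vanish and [Psi = t Phi]. *)
From HB Require Import structures.
From mathcomp Require Import all_boot all_order all_algebra.
From mathcomp Require Import boolp classical_sets reals.
From mathcomp Require Import ring lra.
From mathcomp Require Import topology normedtype sequences.
Require Import Defs.

Set Implicit Arguments.
Unset Strict Implicit.
Unset Printing Implicit Defensive.

Import Order.TTheory GRing.Theory Num.Theory numFieldNormedType.Exports.

Local Open Scope ring_scope.

(** * Linear algebra and adjoints *)

(** The polynomial vanishes at [0], which is thus a minimum, so its derivative [b] there is zero.
    The first-variation arguments below rest on this. *)
Lemma linear_term_eq0 (R : realFieldType) (b c : R) :
  (forall t, 0 <= t * b + t ^+ 2 * c) -> b = 0.
Proof.
move=> pos; apply: contrapT => /eqP b0.
have b2 : 0 < b ^+ 2 by rewrite exprn_even_gt0.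
have c1 : 0 < `|c| + 1 by rewrite ltr_wpDl.
have := pos (- b * (`|c| + 1)^-1).
have -> : - b * (`|c| + 1)^-1 * b + (- b * (`|c| + 1)^-1) ^+ 2 * c =
          b ^+ 2 * (`|c| + 1)^-1 ^+ 2 * (c - (`|c| + 1)).
  by field; rewrite gt_eqF.
rewrite pmulr_rge0; first by have := ler_norm c; lra.
by rewrite mulr_gt0 // exprn_gt0 // invr_gt0.
Qed.

Section VectorSpaces.
Variables (K : fieldType) (V : vectType K).
Implicit Types (U W : {vspace V}) (P : V -> Prop).

Lemma dimv_lt U W x : (U <= W)%VS -> x \in W -> x \notin U ->
  (\dim U < \dim W)%N.
Proof.
move=> UW xW; rewrite ltn_neqAle dimvS // andbT; apply: contra => /eqP dimE.
by have /eqP -> : U == W by rewrite eqEdim UW dimE leqnn.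
Qed.

(** A subspace of maximal dimension inside [P] must be all of [P], since any further vector of [P]
    could be adjoined to it. This makes dimension counts available for sets of operators defined by
    estimates. *)
Lemma vspace_of_pred P :
  P 0 -> (forall t x y, P x -> P y -> P (t *: x + y)) ->
  exists U, forall x, x \in U <-> P x.
Proof.
move=> P0 Plin.
pose Q k := `[< exists U, (forall x, x \in U -> P x) /\ \dim U = k >].
have exQ : exists k, Q k.
  exists 0%N; apply/asboolP; exists 0%VS; split; last exact: dimv0.
  by move=> x; rewrite memv0 => /eqP ->.
have leQ k : Q k -> (k <= \dim {:V})%N.
  by move=> /asboolP[U [_ <-]]; rewrite dimvS ?subvf.
case: (ex_maxnP exQ leQ) => k /asboolP[U [UP dimU]] maxk.
exists U => x; split; first exact: UP.
move=> Px; apply: contrapT => /negP xU.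
have /maxk : Q (\dim (U + <[x]>)).
  apply/asboolP; exists (U + <[x]>)%VS; split=> // y /memv_addP[u uU [v]].
  by move=> /vlineP[t ->] ->; rewrite addrC; apply: Plin => //; apply: UP.
rewrite -dimU leqNgt => /negP; apply.
apply: (@dimv_lt _ _ x) => //; first exact: addvSl.
exact: subvP (addvSr _ _) _ (memv_line x).
Qed.

Lemma limg_inj_stable (g : 'End(V)) W :
  (forall x, x \in W -> g x \in W) -> (forall x, x \in W -> g x = 0 -> x = 0) ->
  forall y, y \in W -> exists2 x, x \in W & y = g x.
Proof.
move=> gW ginj y yW.
have /eqP gWE : (g @: W)%VS == W.
  rewrite eqEdim; apply/andP; split.
    by apply/subvP => _ /memv_imgP[x xW ->]; apply: gW.
  rewrite limg_dim_eq //; apply/eqP; rewrite -subv0; apply/subvP => x.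
  by rewrite memv_cap memv_ker memv0 => /andP[xW /eqP/ginj-> //].
by move: yW; rewrite -{1}gWE => /memv_imgP.
Qed.

Lemma lfun_inj_surj (g : 'End(V)) :
  (forall x, g x = 0 -> x = 0) -> exists g', (g' \o g = \1 /\ g \o g' = \1)%VF.
Proof.
move=> ginj; have ker0 : lker g == 0%VS.
  by rewrite -subv0; apply/subvP => x; rewrite memv_ker memv0 => /eqP/ginj->.
exists (g^-1)%VF; split; apply/lfunP => x; rewrite comp_lfunE id_lfunE.
  exact: lker0_lfunK.
exact: lker0_lfunVK.
Qed.

Lemma lfun_noninj (g : 'End(V)) :
  ~ (exists g', (g' \o g = \1 /\ g \o g' = \1)%VF) ->
  exists2 x, x != 0 & g x = 0.
Proof.
move=> gN; apply: contrapT => gx; apply: gN; apply: lfun_inj_surj => x gx0.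
by apply: contrapT => /eqP x0; apply: gx; exists x.
Qed.

End VectorSpaces.

Section LfunArgument.
Variables (K : fieldType) (V W : vectType K) (f : 'Hom(V, W)).

Lemma lfunrD x y : f (x + y) = f x + f y. Proof. exact: linearD. Qed.
Lemma lfunrB x y : f (x - y) = f x - f y. Proof. exact: linearB. Qed.
Lemma lfunrZ t x : f (t *: x) = t *: f x. Proof. exact: linearZ. Qed.
Lemma lfunr_sum I (r : seq I) (F : I -> V) :
  f (\sum_(i <- r) F i) = \sum_(i <- r) f (F i).
Proof. exact: linear_sum. Qed.
Lemma lfunr0 : f 0 = 0. Proof. exact: linear0. Qed.

End LfunArgument.

Section LeftComposition.
Variables (K : fieldType) (V : vectType K) (T : 'End(V)).

(** Left multiplication as an endomorphism of ['End(V)]: [limg_inj_stable] then solves equations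
    [T S = S'] inside a subspace of operators. *)
Definition lcomp_fun (S : 'End(V)) : 'End(V) := (T \o S)%VF.

Fact lcomp_fun_is_linear : linear lcomp_fun.
Proof. by move=> t S S'; rewrite /lcomp_fun comp_lfunDr comp_lfunZr. Qed.

HB.instance Definition _ :=
  GRing.isLinear.Build K 'End(V) 'End(V) _ lcomp_fun lcomp_fun_is_linear.

Definition lcomp : 'End('End(V)) := linfun lcomp_fun.

Lemma lcompE S : lcomp S = (T \o S)%VF.
Proof. by rewrite lfunE. Qed.

End LeftComposition.

Section Adjoints.
Variable R : realType.
Implicit Types (H K L : finHilbertType R).

Lemma adjPr H K (f : 'Hom(H, K)) x y : inner y (f x) = inner (adj f y) x.
Proof. by rewrite innerC adjP innerC. Qed.

Lemma adj_id H : adj \1%VF = \1%VF :> 'End(H).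
Proof. by apply/esym/adj_unique => x y; rewrite !id_lfunE. Qed.

Lemma adjK H K (f : 'Hom(H, K)) : adj (adj f) = f.
Proof. by apply/esym/adj_unique => x y; rewrite adjPr. Qed.

Lemma adj_comp H K L (f : 'Hom(K, L)) (g : 'Hom(H, K)) :
  adj (f \o g)%VF = (adj g \o adj f)%VF.
Proof. by apply/esym/adj_unique => x y; rewrite !comp_lfunE !adjP. Qed.

Lemma adjD H K (f g : 'Hom(H, K)) : adj (f + g) = adj f + adj g.
Proof.
by apply/esym/adj_unique => x y; rewrite !add_lfunE innerDl innerDr !adjP.
Qed.

Lemma adjZ H K t (f : 'Hom(H, K)) : adj (t *: f) = t *: adj f.
Proof.
by apply/esym/adj_unique => x y; rewrite !scale_lfunE innerZl innerZr !adjP.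
Qed.

Lemma adjB H K (f g : 'Hom(H, K)) : adj (f - g) = adj f - adj g.
Proof. by rewrite adjD -scaleN1r adjZ scaleN1r. Qed.

Lemma inner_ge0 H (x : H) : 0 <= inner x x.
Proof.
by have [->|/inner_gt0/ltW//] := eqVneq x 0; rewrite inner0r.
Qed.

Lemma inner0l H (x : H) : inner 0 x = 0.
Proof. by rewrite innerC inner0r. Qed.

Lemma innerBl H (x y z : H) : inner (x - y) z = inner x z - inner y z.
Proof. by rewrite innerC innerBr !(innerC z). Qed.

Definition isub H (U : {vspace H}) : 'Hom(subvs_of U, H) := linfun vsval.

Lemma isubE H (U : {vspace H}) x : isub U x = vsval x.
Proof. by rewrite lfunE. Qed.

Lemma inner_isub H (U : {vspace H}) x y :
  inner (isub U x) (isub U y) = inner x y.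
Proof. by rewrite !isubE. Qed.

Lemma isubK H (U : {vspace H}) : (adj (isub U) \o isub U)%VF = \1%VF.
Proof.
apply/lfunP => x; apply: inner_injr => y.
by rewrite comp_lfunE -adjP inner_isub id_lfunE.
Qed.

Definition oproj H (U : {vspace H}) : 'End(H) := (isub U \o adj (isub U))%VF.

Section Oproj.
Variables (H : finHilbertType R) (U : {vspace H}).

Lemma adj_oproj : adj (oproj U) = oproj U.
Proof. by rewrite /oproj adj_comp adjK. Qed.

Lemma mem_oproj x : oproj U x \in U.
Proof. by rewrite /oproj comp_lfunE isubE subvsP. Qed.

Lemma oproj_id x : x \in U -> oproj U x = x.
Proof.
move=> xU; have -> : x = isub U (vsproj U x) by rewrite isubE vsprojK.
by rewrite /oproj comp_lfunE -(comp_lfunE _ (isub U)) isubK id_lfunE.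
Qed.

Lemma oproj_orth x y : y \in U -> inner (x - oproj U x) y = 0.
Proof.
move=> yU; rewrite -[y in LHS](oproj_id yU) adjPr adj_oproj linearB /=.
by rewrite (oproj_id (mem_oproj x)) subrr inner0l.
Qed.

End Oproj.

(** The component of [y] orthogonal to the range lies in the kernel of [adj f], so it is orthogonal
    to [y] and hence to itself. *)
Lemma mem_orth_limg H K (f : 'Hom(H, K)) y :
  (forall z, adj f z = 0 -> inner y z = 0) -> y \in limg f.
Proof.
move=> yP; set U := limg f.
have fz x : inner (f x) (y - oproj U y) = 0.
  by rewrite innerC oproj_orth // memv_img ?memvf.
have /yP yz : adj f (y - oproj U y) = 0.
  by apply: inner_injr => x; rewrite -adjP fz inner0r.
have /inner_eq0/subr0_eq -> : inner (y - oproj U y) (y - oproj U y) = 0.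
  by rewrite innerBl yz [X in _ - X]innerC oproj_orth ?subrr ?mem_oproj.
exact: mem_oproj.
Qed.

Section Rank1.
Variables (H K : finHilbertType R) (y : K) (x : H).

Definition rank1_fun (z : H) : K := inner x z *: y.

Fact rank1_fun_is_linear : linear rank1_fun.
Proof. by move=> t u v; rewrite /rank1_fun innerDr innerZr scalerDl scalerA. Qed.

HB.instance Definition _ :=
  GRing.isLinear.Build R H K _ rank1_fun rank1_fun_is_linear.

Definition rank1 : 'Hom(H, K) := linfun rank1_fun.

Lemma rank1E z : rank1 z = inner x z *: y.
Proof. by rewrite lfunE. Qed.

End Rank1.

Lemma adj_rank1 H K (y : K) (x : H) : adj (rank1 y x) = rank1 x y.
Proof.
apply/esym/adj_unique => u v; rewrite !rank1E innerZl innerZr.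
by rewrite mulrC (innerC x).
Qed.

Lemma sym_psd_eq0 H (X : 'End(H)) :
  adj X = X -> (forall x, inner x (X x) = 0) -> X = 0.
Proof.
move=> symX X0; apply/lfunP => y; apply: inner_injr => x.
have := X0 (x + y); rewrite linearD !(innerDl, innerDr) !X0 /=.
rewrite (adjPr X y) symX innerC zero_lfunE inner0r => ?; lra.
Qed.

(* Symmetric Gaussian elimination: subtracting a rank one term enlarges the
   kernel, and leaves room in the orthogonal of the range of the root of the
   remainder for a root of that term. *)
Lemma psd_positive H (X : 'End(H)) :
  adj X = X -> (forall x, 0 <= inner x (X x)) -> positive_op X.
Proof.
have [n] := ubnP (\dim {:H} - \dim (lker X)).
elim: n => // n IHn in X *; rewrite ltnS => dimX symX posX.
have [->|X0] := eqVneq X 0.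
  by exists 0; apply/lfunP => x; rewrite comp_lfunE !zero_lfunE linear0.
have [x] : exists x, 0 < inner x (X x).
  apply: contrapT => Xx; move/eqP: X0; apply; apply: sym_psd_eq0 => // x.
  by apply/eqP/negPn/negP => xX; apply: Xx; exists x; rewrite lt_def posX andbT.
set c := inner x (X x) => c0; pose v := X x.
have vE y : inner v y = inner x (X y) by rewrite adjPr symX.
pose X' := X - c^-1 *: rank1 v v.
have X'E y : X' y = X y - (c^-1 * inner v y) *: v.
  by rewrite add_lfunE opp_lfunE scale_lfunE rank1E scalerA.
have X'x : X' x = 0 by rewrite X'E vE -/c mulVf ?gt_eqF // scale1r subrr.
have symX' : adj X' = X' by rewrite adjB adjZ adj_rank1 symX.
have posX' y : 0 <= inner y (X' y).
  rewrite X'E innerBr innerZr (innerC y v); set b := inner v y.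
  have := posX (y - (c^-1 * b) *: x).
  have -> : X (y - (c^-1 * b) *: x) = X y - (c^-1 * b) *: v.
    by rewrite linearB linearZ.
  rewrite innerBl !innerBr !innerZl !innerZr -vE (innerC y v) -/b -/c.
  have -> : c^-1 * b * (c^-1 * b * c) = c^-1 * b * b.
    by field; rewrite gt_eqF.
  by move=> /le_trans; apply; lra.
have [|S' S'E] := IHn X' _ symX' posX'.
  apply: leq_trans dimX; have kerX : (\dim (lker X) < \dim (lker X'))%N.
    apply: (@dimv_lt _ _ _ _ x); last 2 first.
    - by rewrite memv_ker X'x.
    - by rewrite memv_ker; apply: contraTneq c0 => Xx; rewrite /c Xx inner0r ltxx.
    apply/subvP => y; rewrite !memv_ker X'E vE => /eqP ->.
    by rewrite inner0r mulr0 scale0r subr0.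
  by apply: ltn_sub2l => //; apply: leq_trans kerX _; rewrite dimvS ?subvf.
have S'x : S' x = 0.
  by apply: inner_eq0; rewrite adjP -comp_lfunE -S'E X'x inner0r.
(* Since [S'] kills [x], its adjoint is singular as well. A vector [u] killed by [adj S'] removes
   the cross terms in the square of [S' + k u v^*], and [k] is chosen to make the remaining term
   [c^-1 v v^*]. *)
have [|u u0 S'u] := @lfun_noninj _ _ (adj S').
  move=> [T [_ S'T]]; have : inner x x = inner (S' x) (T x).
    by rewrite adjP -comp_lfunE S'T id_lfunE.
  rewrite S'x inner0l => /inner_eq0 x0.
  by move: c0; rewrite /c x0 inner0l ltxx.
pose k := Num.sqrt (c * inner u u)^-1.
have kk : k * k * inner u u = c^-1.
  rewrite -expr2 sqr_sqrtr ?invr_ge0 ?mulr_ge0 ?inner_ge0 ?(ltW c0) //.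
  by rewrite invfM -mulrA mulVf ?mulr1 // gt_eqF ?inner_gt0.
exists (S' + k *: rank1 u v).
rewrite adjD adjZ adj_rank1; apply/lfunP => y; rewrite comp_lfunE.
rewrite !(add_lfunE, scale_lfunE, rank1E) !linearD !linearZ /=.
rewrite S'u !scaler0 addr0 adjPr S'u inner0l add0r -comp_lfunE -S'E X'E scalerA.
have -> : k * (inner v y * inner u u) * k = c^-1 * inner v y by rewrite -kk; ring.
by rewrite subrK.
Qed.

End Adjoints.

(** * Forms of completely positive maps *)

Section Forms.
Variables (R : realType) (A : realCStarAlgType R).
Implicit Types H K L : finHilbertType R.

Lemma star1 : star (1 : A) = 1.
Proof. by have := starM (star 1 : A) 1; rewrite !(mulr1, starK). Qed.

Definition herm H (f : A -> 'End(H)) := forall a, f (star a) = adj (f a).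

Definition qf H (f : A -> 'End(H)) n (a : 'I_n -> A) (h : 'I_n -> H) : R :=
  \sum_i \sum_j inner (h i) (f (star (a i) * a j) (h j)).

(** Stated with vectors and for bare functions, so that sums, differences and congruences need no
    bundled linear map; [cpP] relates it to [completely_positive]. *)
Definition cp H (f : A -> 'End(H)) :=
  herm f /\ forall n (a : 'I_n -> A) h, 0 <= qf f a h.

Definition cple H (f g : A -> 'End(H)) :=
  forall n (a : 'I_n -> A) h, qf f a h <= qf g a h.

(** [Ad] for an operator between different spaces: it covers compressions ([V] an inclusion) and
    extensions by zero ([V] the adjoint of an inclusion). *)
Definition conj H K (V : 'Hom(K, H)) (f : A -> 'End(H)) (a : A) : 'End(K) :=
  (adj V \o f a \o V)%VF.

Fact conj_is_linear H K (V : 'Hom(K, H)) (f : {linear A -> 'End(H)}) :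
  linear (conj V f).
Proof.
move=> t a b; apply/lfunP => x; rewrite /conj add_lfunE scale_lfunE !comp_lfunE.
by rewrite linearP add_lfunE scale_lfunE linearP.
Qed.

HB.instance Definition _ H K (V : 'Hom(K, H)) (f : {linear A -> 'End(H)}) :=
  GRing.isLinear.Build R A 'End(K) _ (conj V f) (conj_is_linear V f).

Lemma conjE H K (V : 'Hom(K, H)) f a x : conj V f a x = adj V (f a (V x)).
Proof. by rewrite !comp_lfunE. Qed.

Lemma inner_conj H K (V : 'Hom(K, H)) f a x y :
  inner x (conj V f a y) = inner (V x) (f a (V y)).
Proof. by rewrite conjE -adjP. Qed.

Lemma conj_comp H K L (V : 'Hom(K, H)) (W : 'Hom(L, K)) f :
  conj W (conj V f) =1 conj (V \o W)%VF f.
Proof. by move=> a; rewrite /conj adj_comp !comp_lfunA. Qed.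

Lemma conj_id H (f : A -> 'End(H)) : conj \1%VF f =1 f.
Proof. by move=> a; rewrite /conj adj_id comp_lfun1l comp_lfun1r. Qed.

Lemma herm_conj H K (V : 'Hom(K, H)) f : herm f -> herm (conj V f).
Proof. by move=> hf a; rewrite /conj hf !adj_comp adjK comp_lfunA. Qed.

Section Qf.
Variables (H : finHilbertType R) (n : nat) (a : 'I_n -> A).
Implicit Types (f g : A -> 'End(H)) (h k : 'I_n -> H).

Lemma eq_qf f g h : f =1 g -> qf f a h = qf g a h.
Proof. by move=> fg; do 2!apply: eq_bigr => ? _; rewrite fg. Qed.

Lemma eq_qfr f h k : h =1 k -> qf f a h = qf f a k.
Proof. by move=> hk; do 2!apply: eq_bigr => ? _; rewrite !hk. Qed.

Lemma qfD f g h : qf (f \+ g) a h = qf f a h + qf g a h.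
Proof.
rewrite -big_split; apply: eq_bigr => i _; rewrite -big_split.
by apply: eq_bigr => j _; rewrite add_lfunE innerDr.
Qed.

Lemma qfZ t f h : qf (t \*: f) a h = t * qf f a h.
Proof.
rewrite big_distrr; apply: eq_bigr => i _; rewrite big_distrr.
by apply: eq_bigr => j _; rewrite scale_lfunE innerZr.
Qed.

Lemma qfB f g h : qf (f \- g) a h = qf f a h - qf g a h.
Proof.
rewrite -mulN1r -qfZ -qfD; apply: eq_qf => b /=.
by rewrite scaleN1r.
Qed.

Lemma qf_conj K (V : 'Hom(H, K)) (f : A -> 'End(K)) h :
  qf (conj V f) a h = qf f a (V \o h).
Proof. by do 2!apply: eq_bigr => ? _; rewrite inner_conj. Qed.

Lemma qfZr t f h : qf f a (fun i => t *: h i) = t ^+ 2 * qf f a h.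
Proof.
rewrite big_distrr; apply: eq_bigr => i _; rewrite big_distrr.
by apply: eq_bigr => j _; rewrite lfunrZ innerZl innerZr mulrA.
Qed.

Lemma qf_parallelogram f h k :
  qf f a (fun i => h i + k i) + qf f a (fun i => h i - k i) =
  2 * qf f a h + 2 * qf f a k.
Proof.
rewrite !big_distrr -!big_split; apply: eq_bigr => i _.
rewrite !big_distrr -!big_split; apply: eq_bigr => j _.
rewrite lfunrD lfunrB !(innerBl, innerBr, innerDl, innerDr) /=; lra.
Qed.

Lemma qf_le_parallelogram f h k :
  cp f -> qf f a (fun i => h i + k i) <= 2 * qf f a h + 2 * qf f a k.
Proof. by move=> [_ f0]; rewrite -qf_parallelogram lerDl. Qed.

End Qf.

Lemma qf1 H (f : A -> 'End(H)) x :
  qf f (fun _ : 'I_1 => 1) (fun=> x) = inner x (f 1 x).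
Proof. by rewrite /qf !big_ord1 star1 mul1r. Qed.

Definition pair2 T (x y : T) (i : 'I_2) := if i == 0 then x else y.

Lemma qf2 H (f : A -> 'End(H)) a x y : herm f ->
  qf f (pair2 1 a) (pair2 x y) =
  inner x (f 1 x) + 2 * inner x (f a y) + inner y (f (star a * a) y).
Proof.
move=> hf; rewrite /qf !big_ord_recl !big_ord0 /pair2 /= !addr0 star1 !mul1r mulr1.
rewrite hf [inner y (adj _ _)]innerC -adjPr; lra.
Qed.

(** A Cauchy-Schwarz argument: at the elements [1, a] and the vectors [x, t y] the form is
    [2 t b + t^2 c], so [b = <x, f a y>] vanishes; hermitian symmetry moves [f] onto [x]. *)
Lemma cp_eq0 H (f : A -> 'End(H)) x : cp f -> inner x (f 1 x) = 0 ->
  forall a, f a x = 0.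
Proof.
move=> [hf f0] fx0.
suff zero a y : inner x (f a y) = 0.
  by move=> a; apply: inner_injr => y; rewrite inner0r adjPr -hf innerC zero.
set b := inner x (f a y); set c := inner y (f (star a * a) y).
have pos t : 0 <= 2 * (t * b) + t ^+ 2 * c.
  have := f0 _ (pair2 1 a) (pair2 x (t *: y)); rewrite qf2 // fx0 add0r.
  by rewrite !lfunrZ !innerZr innerZl -/b -/c expr2 mulrA.
apply: (@linear_term_eq0 _ _ (c / 2)) => t.
have := pos t; have -> : 2 * (t * b) + t ^+ 2 * c = 2 * (t * b + t ^+ 2 * (c / 2)).
  by field.
by rewrite pmulr_rge0.
Qed.

Lemma cpP H (f : {linear A -> 'End(H)}) : completely_positive f <-> cp f.
Proof.
split=> -[hf f0]; split=> // n a.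
  move=> h; have [/existsP[i h0]|] := boolP [exists i, h i != 0]; last first.
    rewrite negb_exists => /forallP h0; rewrite /qf big1 // => i _.
    have /negPn/eqP -> := h0 i; by rewrite big1 // => j _; rewrite inner0l.
  (* These operators send the fixed nonzero vector [h i] to [<h i, h i>] times [h j], so the
     operator sum evaluated at [h i] is a positive multiple of the form. *)
  have [S SE] := f0 n a (fun j => rank1 (h j) (h i)).
  have : 0 <= inner (h i) ((adj S \o S)%VF (h i)).
    by rewrite comp_lfunE -adjP inner_ge0.
  have -> : inner (h i) ((adj S \o S)%VF (h i)) =
            inner (h i) (h i) * inner (h i) (h i) * qf f a h.
    rewrite -SE sum_lfunE inner_sumr /qf big_distrr; apply: eq_bigr => k _.
    rewrite sum_lfunE inner_sumr /= big_distrr; apply: eq_bigr => l _ /=.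
    by rewrite !comp_lfunE -adjP !rank1E lfunrZ innerZl innerZr mulrA.
  have hh := inner_gt0 h0; rewrite pmulr_rge0 //; exact: mulr_gt0.
move=> T; apply: psd_positive.
  apply/esym/adj_unique => x y.
  rewrite !sum_lfunE inner_suml inner_sumr.
  under eq_bigr => i _ do rewrite sum_lfunE inner_suml.
  under [RHS]eq_bigr => i _ do rewrite sum_lfunE inner_sumr.
  rewrite exchange_big; do 2!apply: eq_bigr => ? _.
  rewrite !comp_lfunE -adjP -adjPr adjP.
  by rewrite -hf starM starK.
move=> x; rewrite sum_lfunE inner_sumr.
rewrite (eq_bigr (fun i => \sum_j inner (T i x) (f (star (a i) * a j) (T j x)))).
  exact: f0.
move=> i _; rewrite sum_lfunE inner_sumr; apply: eq_bigr => j _.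
by rewrite !comp_lfunE -adjP.
Qed.

Lemma cpD H (f g : A -> 'End(H)) : cp f -> cp g -> cp (f \+ g).
Proof.
move=> [hf f0] [hg g0]; split=> [a|n a h]; first by rewrite /= hf hg adjD.
by rewrite qfD addr_ge0.
Qed.

Lemma cpZ H t (f : A -> 'End(H)) : 0 <= t -> cp f -> cp (t \*: f).
Proof.
move=> t0 [hf f0]; split=> [a|n a h]; first by rewrite /= hf adjZ.
by rewrite qfZ mulr_ge0.
Qed.

Lemma cpB H (f g : A -> 'End(H)) : herm f -> herm g -> cple g f -> cp (f \- g).
Proof.
move=> hf hg fg; split=> [a|n a h]; first by rewrite /= hf hg adjB.
by rewrite qfB subr_ge0.
Qed.

Lemma cp_conj H K (V : 'Hom(K, H)) f : cp f -> cp (conj V f).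
Proof.
move=> [hf f0]; split; first exact: herm_conj.
by move=> n a h; rewrite qf_conj.
Qed.

End Forms.

(** * Congruence with a C*-extreme map *)

Section Domination.
Variables (R : realType) (A : realCStarAlgType R).
Implicit Types H K : finHilbertType R.

Definition dom H (f g : A -> 'End(H)) :=
  exists c, forall n (a : 'I_n -> A) h, qf f a h <= c * qf g a h.

Lemma domP H (f g : A -> 'End(H)) : cp g -> dom f g ->
  exists2 c, 0 < c & forall n (a : 'I_n -> A) h, qf f a h <= c * qf g a h.
Proof.
move=> [_ g0] [c fg]; exists (`|c| + 1); first by rewrite ltr_wpDl.
move=> n a h; apply: le_trans (fg _ _ _) _; apply: ler_wpM2r => //.
by have := ler_norm c; lra.
Qed.

Lemma dom_trans H (g f k : A -> 'End(H)) :
  cp g -> dom f g -> dom g k -> dom f k.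
Proof.
move=> cpg /(domP cpg)[c c0 fg] [d gk]; exists (c * d) => n a h.
by apply: le_trans (fg _ _ _) _; rewrite -mulrA ler_wpM2l // ltW.
Qed.

Lemma dom_conj H K (V : 'Hom(K, H)) (f g : A -> 'End(H)) :
  dom f g -> dom (conj V f) (conj V g).
Proof. by move=> [c fg]; exists c => n a h; rewrite !qf_conj. Qed.

Lemma eq_dom H (f f' g g' : A -> 'End(H)) :
  f =1 f' -> g =1 g' -> dom f g -> dom f' g'.
Proof.
move=> ff' gg' [c fg]; exists c => n a h.
by rewrite -(eq_qf _ _ ff') -(eq_qf _ _ gg').
Qed.

Lemma ucpP H (f : {linear A -> 'End(H)}) : UCP f <-> cp f /\ f 1 = \1%VF.
Proof. by split=> -[/cpP ? ?]. Qed.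

(** [S] is a root of [Psi 1]. Evaluated at [1], the domination of [Phi] bounds [<x, x>] by a
    multiple of [<S x, S x>], so [S] is invertible and conjugating by its inverse makes [Psi]
    unital. *)
Lemma cp_normalize H (Phi : A -> 'End(H)) (Psi : {linear A -> 'End(H)}) :
  Phi 1 = \1%VF -> cp Psi -> dom Phi Psi ->
  exists S (Om : {linear A -> 'End(H)}),
    [/\ invertible_op S, UCP Om & Psi =1 conj S Om].
Proof.
move=> Phi1 cpPsi /(domP cpPsi)[c c0 PhiPsi].
have [S SE] : positive_op (Psi 1).
  have /cpP[_ pos] := cpPsi.
  have := pos 1%N (fun=> 1) (fun=> \1%VF).
  by rewrite !big_ord1 star1 mul1r adj_id comp_lfun1l comp_lfun1r.
have [|S' [S'S SS']] := @lfun_inj_surj _ _ S.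
  move=> x Sx; have := PhiPsi _ (fun _ : 'I_1 => 1) (fun=> x).
  rewrite !qf1 Phi1 id_lfunE SE comp_lfunE -adjP Sx inner0r mulr0 => xx.
  by apply: inner_eq0; apply/eqP; rewrite eq_le xx inner_ge0.
exists S, (conj S' Psi : {linear _ -> _}); split; first by exists S'.
  apply/ucpP; split; first exact: cp_conj.
  by rewrite /= /conj SE comp_lfunA -adj_comp -comp_lfunA SS' adj_id comp_lfun1l.
by move=> a; rewrite conj_comp S'S conj_id.
Qed.

(* The part of C*-extremality that passes to invariant subspaces: [Phi] is a
   C*-convex combination of [Om] and another map as soon as [Phi] dominates a
   nondegenerate compression of [Om]. *)
Definition rigid H (Phi : A -> 'End(H)) :=
  forall (Om : {linear A -> 'End(H)}) T,
    UCP Om -> invertible_op T -> dom (conj T Om) Phi ->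
    unitarily_equivalent Om Phi.

Lemma invertible_opZ H t (T : 'End(H)) :
  t != 0 -> invertible_op T -> invertible_op (t *: T).
Proof.
move=> t0 [S [ST TS]]; exists (t^-1 *: S).
by split; rewrite -comp_lfunZl -comp_lfunZr scalerA ?mulVf ?mulfV // scale1r.
Qed.

(** Scaling [T] by a small [t] brings the compression of [Om] below [Phi / 2]. The difference then
    dominates [Phi / 2], so it can be normalized and is the second term of a C*-convex
    combination. *)
Lemma cstar_extreme_rigid H (Phi : {linear A -> 'End(H)}) :
  cstar_extreme Phi -> rigid Phi.
Proof.
move=> [/ucpP[cpPhi Phi1] ext] Om T ucpOm invT [c ToPhi].
have /ucpP[cpOm Om1] := ucpOm.
pose t := (2 * (1 + `|c|))^-1.
have c1 : 1 <= 1 + `|c| by rewrite lerDl.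
have t0 : 0 < t by rewrite invr_gt0; lra.
have tc : t ^+ 2 * c <= 2^-1.
  have -> : 2^-1 = t ^+ 2 * (2 * (1 + `|c|) ^+ 2).
    by rewrite /t; field; rewrite gt_eqF //; lra.
  rewrite ler_wpM2l ?exprn_ge0 ?ltW //.
  have := ler_norm c; have := normr_ge0 c; nra.
have half n (a : 'I_n -> A) h : qf (conj (t *: T) Om) a h <= 2^-1 * qf Phi a h.
  rewrite qf_conj (@eq_qfr _ _ _ _ _ _ _ (fun i => t *: T (h i))); last first.
    by move=> i /=; rewrite scale_lfunE.
  rewrite qfZr; have := ToPhi n a h; rewrite qf_conj => ToPhi'.
  apply: le_trans (ler_wpM2l (exprn_ge0 2 (ltW t0)) ToPhi') _.
  by rewrite mulrA ler_wpM2r //; apply: cpPhi.2.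
pose Phi' : {linear A -> 'End(H)} := Phi \- conj (t *: T) Om.
have cpPhi' : cp Phi'.
  apply: cpB; [exact: cpPhi.1 | exact: herm_conj cpOm.1 |].
  by move=> n a h; have := half n a h; have := cpPhi.2 n a h; lra.
have [|S [Om' [invS ucpOm' Phi'E]]] := cp_normalize Phi1 cpPhi'.
  by exists 2 => n a h; rewrite qfB; have := half n a h; lra.
pose Phis (i : 'I_2) : {linear A -> 'End(H)} := pair2 Om Om' i.
pose Ts (i : 'I_2) : 'End(H) := pair2 (t *: T) S i.
have PhiE a : Phi a = conj (t *: T) Om a + conj S Om' a.
  by rewrite -Phi'E /= addrC subrK.
apply: (ext 2%N Phis Ts _ _ _ _ ord0).
- by move=> i; rewrite /Phis /pair2; case: ifP.
- move=> i; rewrite /Ts /pair2; case: ifP => // _.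
  by apply: invertible_opZ => //; rewrite gt_eqF.
- rewrite !big_ord_recl big_ord0 addr0 /Ts /pair2 /= -Phi1 PhiE /conj Om1.
  by case/ucpP: ucpOm' => _ ->; rewrite !comp_lfun1r.
- by move=> a; rewrite !big_ord_recl big_ord0 addr0 PhiE.
Qed.

(** Normalizing gives [Psi = conj S Om]; rigidity gives a unitary [U] between [Om] and [Phi], and
    [Z] is [U^* S]. *)
Lemma rigid_congruent H (Phi Psi : {linear A -> 'End(H)}) :
  UCP Phi -> rigid Phi -> cp Psi -> dom Phi Psi -> dom Psi Phi ->
  exists2 Z, invertible_op Z & Psi =1 conj Z Phi.
Proof.
move=> /ucpP[cpPhi Phi1] rigPhi cpPsi PhiPsi PsiPhi.
have [S [Om [invS ucpOm PsiE]]] := cp_normalize Phi1 cpPsi PhiPsi.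
have [|U [[UU UU'] PhiE]] := rigPhi Om S ucpOm invS.
  exact: eq_dom PsiE (fun=> erefl) PsiPhi.
have [S' [S'S SS']] := invS.
exists (adj U \o S)%VF.
  exists (S' \o U)%VF; split.
    by rewrite comp_lfunA -(comp_lfunA S') UU' comp_lfun1r.
  by rewrite comp_lfunA -(comp_lfunA (adj U)) SS' comp_lfun1r.
move=> a; rewrite PsiE -conj_comp; congr (adj S \o _ \o S)%VF.
by rewrite /conj adjK PhiE /Ad !comp_lfunA UU' comp_lfun1l -comp_lfunA UU' comp_lfun1r.
Qed.

End Domination.

(** * Limits of bounded sequences of operators *)

Section OperatorLimits.
Local Open Scope classical_set_scope.
Variable R : realType.

(** [p] is a cluster point in a compact box. Instead of a subsequence, a filter finer than the tails
    of [z] converges to [p], and limits along it are unique. *)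
Lemma bounded_rV_cluster d (z : nat -> 'rV[R]_d) M :
  (forall n i, `|z n ord0 i| <= M) ->
  exists p, forall (g : 'rV[R]_d -> R) l, continuous g -> g \o z @ \oo --> l ->
    g p = l.
Proof.
move=> zM; pose K := [set v : 'rV[R]_d | forall i, `[- M, M] (v ord0 i)].
have cptK : compact K 
  by apply: (@rV_compact _ _ (fun=> `[- M, M]%classic)) => _; apply: segment_compact.
have [|p [_]] := cptK (z @ \oo) _.
  by exists 0%N => // n _ i /=; rewrite in_itv /= -ler_norml.
rewrite cluster_cvgE => -[G PG [Gp zG]]; exists p => g l cg gl.
apply: (@cvg_unique _ (@Rhausdorff R) (g @ G) (fmap_proper_filter _ PG)).
  exact: cvg_trans (cvg_app g Gp) (cg p).
by apply: cvg_trans gl => B; apply: zG.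
Qed.

Lemma continuous_sum (T : topologicalType) I (r : seq I) (f : I -> T -> R) :
  (forall i, continuous (f i)) -> continuous (fun z => \sum_(i <- r) f i z).
Proof.
move=> cf; elim: r => [|i r IHr].
  rewrite (_ : (fun z => _) = fun=> 0); first exact: cst_continuous.
  by apply/funext => z; rewrite big_nil.
rewrite (_ : (fun z => _) = f i \+ (fun z => \sum_(i <- r) f i z)).
  by move=> z; apply: cvgD; [exact: cf | exact: IHr].
by apply/funext => z; rewrite big_cons.
Qed.

Lemma continuous_bilinear_rV d (V : vectType R) (N : 'Hom('rV[R]_d, V))
    (b : V -> V -> R) :
  (forall x t y z, b x (t *: y + z) = t * b x y + b x z) ->
  (forall x t y z, b (t *: y + z) x = t * b y x + b z x) ->
  continuous (fun z => b (N z) (N z)).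
Proof.
move=> blinr blinl; pose e i := N (delta_mx ord0 i).
have br0 x : b x 0 = 0.
  by have := blinr x (-1) 0 0; rewrite scaler0 addr0 mulN1r addNr.
have bl0 x : b 0 x = 0.
  by have := blinl x (-1) 0 0; rewrite scaler0 addr0 mulN1r addNr.
have NE z : N z = \sum_i z ord0 i *: e i.
  rewrite {1}(row_sum_delta z) linear_sum; apply: eq_bigr => i _.
  exact: lfunrZ.
have bE z : b (N z) (N z) = \sum_i \sum_j z ord0 i * (z ord0 j * b (e i) (e j)).
  have sumr x (r : seq 'I_d) :
      b x (\sum_(i <- r) z ord0 i *: e i) = \sum_(i <- r) z ord0 i * b x (e i).
    elim: r => [|i r IHr]; first by rewrite !big_nil br0.
    by rewrite !big_cons blinr IHr.
  have suml x (r : seq 'I_d) :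
      b (\sum_(i <- r) z ord0 i *: e i) x = \sum_(i <- r) z ord0 i * b (e i) x.
    elim: r => [|i r IHr]; first by rewrite !big_nil bl0.
    by rewrite !big_cons blinl IHr.
  rewrite NE suml; apply: eq_bigr => i _.
  by rewrite sumr big_distrr.
rewrite (_ : (fun z => _) = fun z : 'rV[R]_d =>
  \sum_i \sum_j z ord0 i * (z ord0 j * b (e i) (e j))); last exact/funext.
do 2!apply: continuous_sum => ?.
move=> z; apply: (@continuousM _ _ (fun z : 'rV[R]_d => z ord0 _)).
  exact: coord_continuous.
apply: (@continuousM _ _ (fun z : 'rV[R]_d => z ord0 _)).
  exact: coord_continuous.
exact: cst_continuous.
Qed.

(** Operators are encoded as row vectors by their matrices of inner products on a basis, where
    compactness applies; the expressions to be passed to the limit are quadratic in these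
    coordinates. *)
Lemma op_limit (H : finHilbertType R) (Z : nat -> 'End(H)) (c : H -> R) :
  (forall n x, inner (Z n x) (Z n x) <= c x) ->
  exists Z' : 'End(H), forall (T : 'End(H)) x y l m,
    (forall n, inner (Z n x) (T (Z n y)) = l + n.+1%:R^-1 * m) ->
    inner (Z' x) (T (Z' y)) = l.
Proof.
move=> Zc; pose d : nat := \dim {:H}; pose X := vbasis {:H}.
pose gram (T : 'End(H)) : 'rV[R]_(d * d) :=
  mxvec (\matrix_(i, j) inner X`_i (T X`_j)).
have gramlin : linear gram.
  move=> t T U; rewrite /gram -linearP; congr mxvec; apply/matrixP => i j.
  by rewrite !mxE add_lfunE scale_lfunE innerDr innerZr.
pose L : 'Hom('End(H), 'rV[R]_(d * d)) :=
  linfun (HB.pack gram (GRing.isLinear.Build R _ _ _ _ gramlin)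
          : {linear 'End(H) -> 'rV[R]_(d * d)}).
have kerL : lker L == 0%VS.
  rewrite -subv0; apply/subvP => T; rewrite memv_ker memv0 => /eqP LT0.
  apply/eqP/lfunP => y; rewrite zero_lfunE (coord_vbasis (memvf y)) lfunr_sum.
  apply: big1 => j _; rewrite lfunrZ; apply/eqP; rewrite scaler_eq0; apply/orP.
  right; apply/eqP/inner_injr => x; rewrite inner0r.
  rewrite (coord_vbasis (memvf x)) inner_suml; apply: big1 => i _.
  move: LT0; rewrite lfunE /= /gram => /(congr1 vec_mx); rewrite mxvecK linear0.
  by move=> /matrixP/(_ i j); rewrite !mxE innerZl => ->; rewrite mulr0.
(* The entries are bounded through [2 |<x, Z y>| <= <x, x> + <Z y, Z y>]; the sum over the basis
   serves as one bound for all of them. *)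
have [|p pP] := @bounded_rV_cluster _ (L \o Z) (\sum_(i < d) (inner X`_i X`_i + c X`_i)).
  move=> n k; case/mxvec_indexP: k => i j; rewrite /= lfunE /= mxvecE mxE.
  set x := X`_i; set y := X`_j.
  have c0 u : 0 <= c u by apply: le_trans (inner_ge0 (Z n u)) (Zc n u).
  have B0 u : 0 <= inner u u + c u by rewrite addr_ge0 // inner_ge0.
  have leB (k : 'I_d) :
      inner X`_k X`_k + c X`_k <= \sum_(i < d) (inner X`_i X`_i + c X`_i).
    by rewrite (bigD1 k) //= lerDl sumr_ge0.
  have := leB i; have := leB j; rewrite -/x -/y; have := Zc n y; have := c0 x.
  have := inner_ge0 (x + Z n y); have := inner_ge0 (x - Z n y).
  rewrite !(innerBl, innerBr, innerDl, innerDr) (innerC (Z n y) x).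
  have := inner_ge0 y; rewrite ler_norml; lra.
exists (L^-1%VF p) => T x y l m ZT.
pose b (U V : 'End(H)) := inner (U x) (T (V y)).
apply: (pP (fun z => b (L^-1 z)%VF (L^-1 z)%VF)).
  apply: continuous_bilinear_rV => [U t V W|U t V W]; rewrite /b.
    by rewrite add_lfunE scale_lfunE lfunrD lfunrZ innerDr innerZr.
  by rewrite add_lfunE scale_lfunE innerDl innerZl.
rewrite (_ : _ \o _ = fun n => l + harmonic n * m); last first.
  by apply/funext => n; rewrite /= lker0_lfunK // /b ZT.
rewrite -[X in _ --> X]addr0 -(mul0r m); apply: cvgD; first exact: cvg_cst.
by apply: cvgM; [exact: cvg_harmonic | exact: cvg_cst].
Qed.

End OperatorLimits.

(** * Irreducible maps *)

Definition invariant (R : realType) (A : realCStarAlgType R)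
    (H : finHilbertType R) (f : A -> 'End(H)) (U : {vspace H}) :=
  forall a x, x \in U -> f a x \in U.

Definition irreducible (R : realType) (A : realCStarAlgType R)
    (H : finHilbertType R) (f : A -> 'End(H)) :=
  forall U, invariant f U -> U = 0%VS \/ U = fullv.

Section Multipliers.
Variables (R : realType) (A : realCStarAlgType R) (H : finHilbertType R).
Variable Phi : {linear A -> 'End(H)}.
Hypotheses (ucpPhi : UCP Phi) (rigPhi : rigid Phi).

Let cpPhi : cp Phi. Proof. by case/ucpP: ucpPhi. Qed.
Let Phi1 : Phi 1 = \1%VF. Proof. by case/ucpP: ucpPhi. Qed.
Let qf_ge0 n (a : 'I_n -> A) h : 0 <= qf Phi a h. Proof. exact: cpPhi.2. Qed.

(** In the Stinespring picture, where [qf Phi a h] is the squared seminorm of the sum of the tensors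
    of [a j] and [h j], this says that applying [V] to the second factor is bounded. *)
Definition multiplier (V : 'End(H)) := dom (conj V Phi) Phi.

Lemma multiplier0 : multiplier 0.
Proof.
exists 0 => n a h; rewrite qf_conj mul0r /qf big1 // => i _; apply: big1 => j _.
by rewrite /= zero_lfunE inner0l.
Qed.

Lemma multiplier1 : multiplier \1%VF.
Proof. by exists 1 => n a h; rewrite (eq_qf _ _ (conj_id _)) mul1r. Qed.

Lemma multiplierP t V W : multiplier V -> multiplier W -> multiplier (t *: V + W).
Proof.
move=> [c VPhi] [d WPhi]; exists (2 * (t ^+ 2 * c) + 2 * d) => n a h.
have := VPhi n a h; have := WPhi n a h; rewrite !qf_conj => Wh Vh.
have -> : qf Phi a ((t *: V + W)%R \o h) =
          qf Phi a (fun i => t *: (V \o h) i + (W \o h) i).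
  by apply: eq_qfr => i /=; rewrite add_lfunE scale_lfunE.
apply: le_trans (qf_le_parallelogram _ _ _ cpPhi) _; rewrite qfZr.
have := ler_wpM2l (sqr_ge0 t) Vh; nra.
Qed.

Lemma multiplier_comp V W : multiplier V -> multiplier W -> multiplier (V \o W)%VF.
Proof.
move=> VPhi WPhi; apply: (eq_dom (conj_comp V W Phi) (fun=> erefl)).
exact: dom_trans (cp_conj W cpPhi) (dom_conj W VPhi) WPhi.
Qed.

(** Adding [t w] with [P w = 0] to [P x] does not change its image, so the norm of [P x + t w] is
    least at [t = 0]: range and kernel are orthogonal. *)
Lemma contractive_idempotent (P : 'End(H)) :
  (P \o P = P)%VF -> (forall x, inner (P x) (P x) <= inner x x) -> adj P = P.
Proof.
move=> PP Pcontr; apply/esym/adj_unique.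
have PE x : P (P x) = P x by rewrite -[LHS]comp_lfunE PP.
have orth x y : inner (P x) (y - P y) = 0.
  have : P (y - P y) = 0 by rewrite lfunrB PE subrr.
  move: (y - P y) => w Pw; apply: (@linear_term_eq0 _ _ (inner w w / 2)) => t.
  have := Pcontr (P x + t *: w); rewrite lfunrD lfunrZ PE Pw scaler0 addr0.
  rewrite !(innerDl, innerDr, innerZl, innerZr). rewrite (innerC w); nra.
move=> x y; have := orth x y; have := orth y x.
rewrite !innerBr => /subr0_eq yx /subr0_eq ->.
by rewrite (innerC (P x)) -yx innerC.
Qed.

(** At [1] the hypothesis makes [P] contractive, hence self-adjoint. The same variation in the form,
    at [1, a] and [P x, t y] with [P y = 0], shows that [Phi a y] is orthogonal to the range of
    [P]. *)
Lemma idempotent_invariant (P : 'End(H)) : (P \o P = P)%VF ->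
  (forall n (a : 'I_n -> A) h, qf (conj P Phi) a h <= qf Phi a h) ->
  invariant Phi (limg P).
Proof.
move=> PP PPhi; have PE x : P (P x) = P x by rewrite -[LHS]comp_lfunE PP.
have adjPP : adj P = P.
  apply: contractive_idempotent => // x.
  have := PPhi _ (fun _ : 'I_1 => 1) (fun=> x).
  by rewrite !qf1 inner_conj Phi1 !id_lfunE.
have orth a x y : P y = 0 -> inner (P x) (Phi a y) = 0.
  move=> Py; apply: (@linear_term_eq0 _ _ (inner y (Phi (star a * a) y) / 2)) => t.
  have := PPhi _ (pair2 1 a) (pair2 (P x) (t *: y)).
  rewrite !qf2; [|exact: cpPhi.1|exact: herm_conj cpPhi.1].
  rewrite !inner_conj !lfunrZ Py !scaler0 PE !lfunr0 !scaler0 !inner0r.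
  rewrite !innerZr innerZl; nra.
move=> a _ /memv_imgP[x _ ->].
suff -> : Phi a (P x) = P (Phi a (P x)) by rewrite memv_img ?memvf.
apply/subr0_eq/inner_eq0; set y := Phi a (P x).
have Py : P (y - P y) = 0 by rewrite lfunrB PE subrr.
rewrite innerBl [X in _ - X]adjP adjPP Py inner0r subr0.
by rewrite adjP -cpPhi.1 orth.
Qed.

Hypothesis irrPhi : irreducible Phi.

(* Conjugating by the root [Z] of [P* Phi P + (1-P)* Phi (1-P)] makes [P]
   orthogonal. *)
Lemma idempotent_multiplier (P : 'End(H)) :
  (P \o P = P)%VF -> multiplier P -> P = 0 \/ P = \1%VF.
Proof.
move=> PP PPhi; pose Q := \1%VF - P.
have QE x : Q x = x - P x by rewrite add_lfunE opp_lfunE id_lfunE.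
have PE x : P (P x) = P x by rewrite -[LHS]comp_lfunE PP.
pose Psi : {linear A -> 'End(H)} := conj P Phi \+ conj Q Phi.
have PsiE n (a : 'I_n -> A) h : qf Psi a h = qf Phi a (P \o h) + qf Phi a (Q \o h).
  by rewrite qfD !qf_conj.
have mQ : multiplier Q.
  have -> : Q = (-1) *: P + \1%VF by rewrite scaleN1r addrC.
  exact: multiplierP multiplier1.
have [|||Z [Z' [Z'Z ZZ']] PsiZ] := @rigid_congruent _ _ _ Phi Psi ucpPhi rigPhi.
- by apply: cpD; apply: cp_conj.
- exists 2 => n a h; rewrite PsiE mulrDr.
  rewrite (@eq_qfr _ _ _ _ _ _ h (fun i => (P \o h) i + (Q \o h) i)).
    exact: qf_le_parallelogram.
  by move=> i /=; rewrite QE addrC subrK.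
- have [c Pc] := PPhi; have [d Qd] := mQ; exists (c + d) => n a h.
  by have := Pc n a h; have := Qd n a h; rewrite PsiE !qf_conj mulrDl; lra.
pose E := (Z \o P \o Z')%VF.
have EE : (E \o E = E)%VF.
  apply/lfunP => x; rewrite !comp_lfunE -(comp_lfunE Z' Z) Z'Z id_lfunE PE.
  by [].
(* Through [Psi = conj Z Phi] the required inequality compares [Psi] at [P k] and at [k]. As
   [Q P = 0], the former is only the first summand of the latter. *)
have invE : invariant Phi (limg E).
  apply: idempotent_invariant => // n a h.
  have -> : qf (conj E Phi) a h = qf Psi a (P \o (Z' \o h)).
    by rewrite (eq_qf _ _ PsiZ) !qf_conj; apply: eq_qfr => i /=; rewrite !comp_lfunE.
  have -> : qf Phi a h = qf Psi a (Z' \o h).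
    rewrite (eq_qf _ _ PsiZ) qf_conj; apply: eq_qfr => i /=.
    by rewrite -comp_lfunE ZZ' id_lfunE.
  rewrite !PsiE; set k := Z' \o h.
  have -> : qf Phi a (Q \o (P \o k)) = 0.
    rewrite /qf big1 // => i _; apply: big1 => j _.
    by rewrite /= QE PE subrr inner0l.
  rewrite (@eq_qfr _ _ _ _ _ _ (P \o (P \o k)) (P \o k)) => [|i /=]; last by [].
  by rewrite addr0 lerDl.
have PZ : P = (Z' \o E \o Z)%VF.
  by rewrite /E !comp_lfunA Z'Z comp_lfun1l -comp_lfunA Z'Z comp_lfun1r.
case: (irrPhi invE) => limE; [left | right].
  have E0 : E = 0.
    apply/lfunP => x; rewrite zero_lfunE; apply/eqP.
    by rewrite -memv0 -limE memv_img ?memvf.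
  by rewrite PZ E0 comp_lfun0r comp_lfun0l.
have -> : P = (Z' \o E \o Z)%VF by [].
have -> : E = \1%VF.
  apply/lfunP => x; rewrite id_lfunE.
  have /memv_imgP[y _ ->] : x \in limg E by rewrite limE memvf.
  by rewrite -[LHS]comp_lfunE EE.
by rewrite comp_lfun1r.
Qed.

Definition singular (T : 'End(H)) := exists2 x, x != 0 & T x = 0.

Let exN : exists N : {vspace 'End(H)}, forall V, V \in N <-> multiplier V.
Proof. exact: vspace_of_pred multiplier0 (@multiplierP). Qed.

(* With [T] of minimal rank among the singular multipliers fixing [x],
   left multiplication by [T] is bijective on the multipliers with range in
   [limg T]; a solution [S] of [T = T S] there is a nontrivial idempotent. *)
Lemma singular_multiplier_fix T x :
  multiplier T -> singular T -> T x = x -> x = 0.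
Proof.
have [N NP] := exN.
have [n] := ubnP (\dim (limg T)); elim: n => // n IHn in T *.
rewrite ltnS => dimT mT [z z0 Tz] Tx; apply: contrapT => /eqP x0.
(* If the rank dropped, the induction hypothesis would apply to the square of [T], which also fixes
   [x]. *)
have TTlim : limg (T \o T)%VF = limg T.
  apply/eqP; rewrite eqEdim limg_comp limgS ?subvf //= leqNgt; apply/negP => lt.
  have /eqP := x0; apply; apply: (IHn (T \o T)%VF).
  - by apply: leq_trans dimT; rewrite limg_comp.
  - exact: multiplier_comp.
  - by exists z => //; rewrite comp_lfunE Tz lfunr0.
  - by rewrite comp_lfunE !Tx.
have Tinj y : y \in limg T -> T y = 0 -> y = 0.
  move=> yT Ty.
  have /eqP : \dim (lker T :&: limg T) = 0%N.
    have := limg_ker_dim T (limg T); rewrite -limg_comp TTlim capvC.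
    by rewrite -[RHS]add0n => /addIn ->.
  rewrite dimv_eq0 -subv0 => /subvP/(_ y); rewrite memv_cap memv_ker Ty eqxx yT.
  by rewrite memv0 => /(_ isT)/eqP.
have [||W WP] := @vspace_of_pred _ _
  (fun S => multiplier S /\ forall y, S y \in limg T).
- by split; [exact: multiplier0 | move=> y; rewrite zero_lfunE rpred0].
- move=> t S S' [mS ST] [mS' S'T]; split; first exact: multiplierP.
  by move=> y; rewrite add_lfunE scale_lfunE rpredD ?rpredZ.
have TW S : S \in W -> (T \o S = 0)%VF -> S = 0.
  move=> /WP[_ ST] TS; apply/lfunP => y; rewrite zero_lfunE; apply: Tinj => //.
  by rewrite -comp_lfunE TS zero_lfunE.
have [|||S SW] := @limg_inj_stable _ _ (lcomp T) W _ _ T.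
- move=> S /WP[mS ST]; apply/WP; rewrite lcompE; split; first exact: multiplier_comp.
  by move=> y; rewrite comp_lfunE memv_img ?memvf.
- by move=> S SW; rewrite lcompE; apply: TW.
- by apply/WP; split=> // y; rewrite memv_img ?memvf.
rewrite lcompE => TS; have /WP[mS ST] := SW.
have SS : (S \o S = S)%VF.
  apply/subr0_eq/TW; last by rewrite comp_lfunDr comp_lfunNr comp_lfunA -!TS subrr.
  apply/WP; split.
    by rewrite addrC -scaleN1r; apply: multiplierP => //; apply: multiplier_comp.
  by move=> y; rewrite add_lfunE opp_lfunE comp_lfunE rpredB.
(* [S = 0] would give [T = 0] although [T x = x]; [S = 1] would put the kernel vector [z] in the
   range of [T], where [T] is injective. *)
case: (idempotent_multiplier SS mS) => SE; move/eqP: x0; apply.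
  by rewrite -Tx TS SE comp_lfun0r zero_lfunE.
move/eqP: z0; case; apply: Tinj => //.
by have := ST z; rewrite SE id_lfunE.
Qed.

(** Choose [x] with an orbit of least dimension under the multipliers. If a singular [T] did not
    kill [x], the orbit of [T x] would be the same, so [x = V (T x)] and the singular multiplier
    [V T] would fix [x]. *)
Lemma exists_common_kernel : (exists x : H, x != 0) ->
  exists2 x : H, x != 0 & forall T, multiplier T -> singular T -> T x = 0.
Proof.
move=> [x0 x0N]; have [N NP] := exN.
pose orbit (x : H) (U : {vspace H}) :=
  forall y, y \in U <-> exists2 V, multiplier V & y = V x.
have orbitP x : exists U, orbit x U.
  apply: vspace_of_pred; first by exists 0; [exact: multiplier0|rewrite zero_lfunE].
  move=> t _ _ [V mV ->] [W mW ->]; exists (t *: V + W); first exact: multiplierP.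
  by rewrite add_lfunE scale_lfunE.
pose Q k := `[< exists x U, [/\ x != 0, orbit x U & \dim U = k] >].
have exQ : exists k, Q k.
  have [U UP] := orbitP x0; exists (\dim U); apply/asboolP; by exists x0, U.
case: (ex_minnP exQ) => k /asboolP[x [U [x0' UP dimU]]] mink.
exists x => // T mT [z z0 Tz]; apply: contrapT => /eqP Tx0.
have [U' U'P] := orbitP (T x).
have U'U : (U' <= U)%VS.
  apply/subvP => y /U'P[V mV ->]; apply/UP; exists (V \o T)%VF.
    exact: multiplier_comp.
  by rewrite comp_lfunE.
have /eqP U'E : U' == U.
  rewrite eqEdim U'U dimU; apply: mink; apply/asboolP; by exists (T x), U'.
have /U'P[V mV xE] : x \in U'.
  by rewrite U'E; apply/UP; exists \1%VF; [exact: multiplier1|rewrite id_lfunE].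
move/eqP: x0'; apply; apply: (@singular_multiplier_fix (V \o T)%VF).
- exact: multiplier_comp.
- by exists z => //; rewrite comp_lfunE Tz lfunr0.
- by rewrite comp_lfunE -xE.
Qed.

(** Left multiplication by [V] is injective on the finite-dimensional space of multipliers, hence
    reaches the identity there. *)
Lemma multiplier_inv V W : multiplier V -> (W \o V = \1)%VF -> multiplier W.
Proof.
move=> mV WV; have [N NP] := exN.
have [|||S /NP mS] := @limg_inj_stable _ _ (lcomp V) N _ _ \1%VF.
- by move=> S /NP mS; apply/NP; rewrite lcompE; apply: multiplier_comp.
- move=> S _; rewrite lcompE => VS.
  by rewrite -[S]comp_lfun1l -WV -comp_lfunA VS comp_lfun0r.
- by apply/NP; apply: multiplier1.
by rewrite lcompE => VS; rewrite -[W]comp_lfun1r VS comp_lfunA WV comp_lfun1l.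
Qed.

(** [Psi + Phi / (n + 1)] is comparable with [Phi] in both directions, hence has a root [Z n];
    evaluation at [1] bounds these roots, and a limit point is a root of [Psi]. *)
Lemma dominated_root (Psi : {linear A -> 'End(H)}) :
  cp Psi -> dom Psi Phi -> exists Z, Psi =1 conj Z Phi.
Proof.
move=> cpPsi PsiPhi; have [c PsiPhi'] := PsiPhi.
have /choice[Z ZP] (n : nat) : exists Z, forall a,
    Psi a + n.+1%:R^-1 *: Phi a = conj Z Phi a.
  pose e : R := n.+1%:R^-1; have e0 : 0 < e by rewrite invr_gt0 ltr0n.
  pose Psi' : {linear A -> 'End(H)} := Psi \+ (e \*: Phi).
  have [||| Z _ ZP] := @rigid_congruent _ _ _ Phi Psi' ucpPhi rigPhi.
  - by apply: cpD => //; apply: cpZ => //; apply: ltW.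
  - exists e^-1 => n' a h; rewrite qfD qfZ mulrDr mulrA mulVf ?gt_eqF // mul1r.
    by rewrite lerDr mulr_ge0 ?invr_ge0 ?(ltW e0) //; apply: cpPsi.2.
  - by exists (c + e) => n' a h; rewrite qfD qfZ mulrDl lerD2r.
  by exists Z.
have [|Z' Z'P] := @op_limit _ _ Z (fun x => inner x (Psi 1 x) + inner x x).
  move=> n x; have /(congr1 (fun T : 'End(H) => inner x (T x))) := ZP n 1.
  rewrite inner_conj Phi1 id_lfunE => <-.
  rewrite add_lfunE scale_lfunE id_lfunE innerDr innerZr lerD2l.
  by rewrite ler_piMl ?inner_ge0 // invf_le1 ?ltr0n // ler1n.
exists Z' => a; apply/lfunP => y; apply: inner_injr => x.
rewrite inner_conj; apply/esym/(Z'P _ _ _ _ (inner x (Phi a y))) => n.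
rewrite -inner_conj -ZP add_lfunE scale_lfunE innerDr innerZr.
by [].
Qed.

(** An invertible root would have a multiplier as inverse, and conjugating by it would make [Psi]
    dominate [Phi]. *)
Lemma nondominating_root (Psi : {linear A -> 'End(H)}) :
  cp Psi -> dom Psi Phi -> ~ dom Phi Psi ->
  exists Z, [/\ Psi =1 conj Z Phi, multiplier Z & singular Z].
Proof.
move=> cpPsi PsiPhi PhiPsi; have [Z ZP] := dominated_root cpPsi PsiPhi.
have mZ : multiplier Z by apply: eq_dom PsiPhi.
exists Z; split=> //; apply: lfun_noninj => -[W [WZ _]]; apply: PhiPsi.
have mW := multiplier_inv mZ WZ.
apply: eq_dom (dom_conj Z mW); last by move=> a; rewrite ZP.
by move=> a; rewrite conj_comp WZ conj_id.
Qed.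

Lemma max_scalar (Psi : A -> 'End(H)) (x0 : H) : x0 != 0 ->
  cp Psi -> cple Psi Phi ->
  exists t, [/\ 0 <= t, forall n (a : 'I_n -> A) h, t * qf Phi a h <= qf Psi a h &
   forall s, (forall n (a : 'I_n -> A) h, s * qf Phi a h <= qf Psi a h) -> s <= t].
Proof.
move=> x0N cpPsi PsiPhi.
pose E := [set t | forall n (a : 'I_n -> A) h, t * qf Phi a h <= qf Psi a h]%classic.
have E0 : E 0 by move=> n a h; rewrite mul0r; apply: cpPsi.2.
have ubE : has_ubound E.
  exists 1 => t /(_ _ (fun _ : 'I_1 => 1) (fun=> x0)) tPsi.
  have := PsiPhi _ (fun _ : 'I_1 => 1) (fun=> x0).
  move=> /(le_trans tPsi); rewrite qf1 Phi1 id_lfunE.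
  by rewrite ger_pMl ?inner_gt0.
have maxE s : E s -> s <= sup E by apply: ub_le_sup.
exists (sup E); split; [exact: maxE | | exact: maxE].
move=> n a h; have [->|q0] := eqVneq (qf Phi a h) 0.
  by rewrite mulr0; apply: cpPsi.2.
have q1 : 0 < qf Phi a h by rewrite lt_def q0 qf_ge0.
rewrite -ler_pdivlMr //; apply: ge_sup; first by exists 0.
by move=> t Et; rewrite ler_pdivlMr.
Qed.

Lemma irreducible_rigid_pure : pure Phi.
Proof.
split; first exact/cpP.
move=> Psi /cpP cpPsi /cpP cpPhiPsi.
have [[x0 x0N]|no] := pselect (exists x : H, x != 0); last first.
  exists 0; split=> [|a]; first by rewrite lexx ler01.
  apply/lfunP => x; have -> : x = 0 by apply: contrapT => /eqP x0; apply: no; exists x.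
  by rewrite !lfunr0.
have PsiPhi : cple Psi Phi.
  by move=> n a h; rewrite -subr_ge0 -qfB; apply: cpPhiPsi.2.
have PhiPsiPhi : cple (Phi \- Psi) Phi.
  by move=> n a h; rewrite qfB gerBl; apply: cpPsi.2.
have remainder (Xi : {linear A -> 'End(H)}) : cp Xi -> cple Xi Phi ->
  exists t (Xi' : {linear A -> 'End(H)}) Z, [/\ 0 <= t, cp Xi',
    forall a, Xi a = t *: Phi a + Xi' a, Xi' =1 conj Z Phi &
    multiplier Z /\ singular Z].
  move=> cpXi XiPhi; have [t [t0 tXi maxt]] := max_scalar x0N cpXi XiPhi.
  pose Xi' : {linear A -> 'End(H)} := Xi \- (t \*: Phi).
  have Xi'E n (a : 'I_n -> A) h : qf Xi' a h = qf Xi a h - t * qf Phi a h.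
    by rewrite qfB qfZ.
  have cpXi' : cp Xi'.
    apply: cpB; [exact: cpXi.1 | exact: (cpZ t0 cpPhi).1 |].
    by move=> n a h; rewrite qfZ.
  have [||Z [ZE mZ sZ]] := nondominating_root cpXi'.
  - exists 1 => n a h; rewrite Xi'E mul1r; apply: le_trans (XiPhi n a h).
    by rewrite gerBl mulr_ge0.
  (* If [Phi <= c Xi'], then [t + c^-1] would be admissible for [Xi], against the maximality of
     [t]. *)
  - move=> /(domP cpXi')[c c0 PhiXi'].
    have /maxt : forall n (a : 'I_n -> A) h, (t + c^-1) * qf Phi a h <= qf Xi a h.
      move=> n a h; have := PhiXi' n a h; rewrite -ler_pdivrMl // Xi'E mulrDl; lra.
    by rewrite gerDl leNgt invr_gt0 c0.
  by exists t, Xi', Z; split=> // a; rewrite /= addrC subrK.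
have [t [Psi1 [Z1 [t0 cpPsi1 PsiE Psi1E [mZ1 sZ1]]]]] := remainder _ cpPsi PsiPhi.
have [s [Psi2 [Z2 [s0 cpPsi2 PhiPsiE Psi2E [mZ2 sZ2]]]]] :=
  remainder (Phi \- Psi) cpPhiPsi PhiPsiPhi.
have PhiE x : inner x x = (t + s) * inner x x + inner x (Psi1 1 x) + inner x (Psi2 1 x).
  have : Phi 1 = t *: Phi 1 + Psi1 1 + (s *: Phi 1 + Psi2 1).
    by rewrite -PsiE -PhiPsiE /= addrC subrK.
  move=> /(congr1 (fun T : 'End(H) => inner x (T x))).
  rewrite !(add_lfunE, scale_lfunE) Phi1 id_lfunE !(innerDr, innerZr); lra.
have [|x xN xker] := exists_common_kernel; first by exists x0.
have ts : t + s = 1.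
  have := PhiE x; rewrite Psi1E Psi2E !inner_conj !xker // !inner0l !addr0.
  move=> /esym xx; apply: (mulIf (negbT (gt_eqF (inner_gt0 xN)))).
  by rewrite mul1r.
exists t; split; first by rewrite t0 -ts lerDl.
(* As [t + s = 1], the two nonnegative remainders add up to zero at [1]; [cp_eq0] carries the
   vanishing of [Psi1] from [1] to every [a]. *)
move=> a; rewrite PsiE -[RHS]addr0; congr (_ + _); apply/lfunP => y.
rewrite zero_lfunE; apply: (cp_eq0 cpPsi1).
have := PhiE y; rewrite ts mul1r -!qf1.
have := cpPsi1.2 _ (fun _ : 'I_1 => 1) (fun=> y).
have := cpPsi2.2 _ (fun _ : 'I_1 => 1) (fun=> y); lra.
Qed.

End Multipliers.

(** * Compression to an invariant subspace *)

Section Compression.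
Variables (R : realType) (A : realCStarAlgType R) (H : finHilbertType R).
Variables (Phi : {linear A -> 'End(H)}) (U : {vspace H}).
Hypotheses (ucpPhi : UCP Phi) (invU : invariant Phi U).

Let cpPhi : cp Phi. Proof. by case/ucpP: ucpPhi. Qed.
Let Phi1 : Phi 1 = \1%VF. Proof. by case/ucpP: ucpPhi. Qed.

Let i := isub U.
Let P := oproj U.
Let Q := \1%VF - P.

Let ii x : adj i (i x) = x.
Proof. by rewrite -[LHS]comp_lfunE isubK id_lfunE. Qed.

Let iiP x : i (adj i x) = P x. Proof. by rewrite -[LHS]comp_lfunE. Qed.

Let QE x : Q x = x - P x.
Proof. by rewrite add_lfunE opp_lfunE id_lfunE. Qed.

Let iQ x : adj i (Q x) = 0.
Proof. by rewrite QE lfunrB -iiP ii subrr. Qed.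

Let Qi x : Q (i x) = 0.
Proof. by rewrite QE -iiP ii subrr. Qed.

Let QQ x : Q (Q x) = Q x.
Proof. by rewrite {1}QE -iiP iQ lfunr0 subr0. Qed.

Let adjQ : adj Q = Q.
Proof. by rewrite /Q adjB adj_id adj_oproj. Qed.

Let inner_iQ x y : inner (i x) (Q y) = 0.
Proof. by rewrite adjP iQ inner0r. Qed.

Let split_norm x : inner x x = inner (adj i x) (adj i x) + inner (Q x) (Q x).
Proof.
have {1 2}-> : x = i (adj i x) + Q x by rewrite iiP QE addrC subrK.
rewrite !(innerDl, innerDr) (innerC (Q x) (i _)) !inner_iQ addr0 add0r.
by rewrite inner_isub.
Qed.

Lemma isub_intertwine a x : Phi a (i x) = i (conj i Phi a x).
Proof.
by rewrite conjE iiP [RHS]oproj_id // invU // /i isubE subvsP.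
Qed.

(** An invariant subspace is reducing, because the operators [Phi a] are closed under adjoints. *)
Lemma oproj_commute a x : P (Phi a x) = Phi a (P x).
Proof.
have PP b y : P (Phi b (P y)) = Phi b (P y).
  by apply: oproj_id; apply: invU; apply: mem_oproj.
rewrite -[RHS]PP; apply: inner_injr => y.
rewrite !(adjPr P) adj_oproj !(adjPr (Phi a)) -cpPhi.1 (adjPr P) adj_oproj.
by rewrite PP.
Qed.

Let Q_commute a x : Q (Phi a x) = Phi a (Q x).
Proof. by rewrite !QE oproj_commute lfunrB. Qed.

Lemma ucp_compression : UCP (conj i Phi).
Proof.
apply/ucpP; split; first exact: cp_conj.
by rewrite /= /conj Phi1 comp_lfun1r isubK.
Qed.

Let qf_split n (a : 'I_n -> A) h :
  qf Phi a h = qf (conj i Phi) a (adj i \o h) + qf Phi a (Q \o h).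
Proof.
rewrite -!qf_conj -qfD; apply: eq_qf => b; apply/lfunP => x /=.
rewrite add_lfunE !conjE !adjK !iiP adjQ Q_commute QQ.
rewrite oproj_commute (oproj_id (mem_oproj U x)) -lfunrD QE.
by rewrite addrC subrK.
Qed.

Section Feedback.
Variable Om : {linear A -> 'End(subvs_of U)}.
Variable V : 'End(H).
Hypothesis unitV : unitary_op V.
(** [V] intertwines [Phi] with the direct sum of [Om] on [U] and the part of [Phi] on the
    complement. *)
Hypothesis VPhi : forall a x, V (Phi a x) = i (Om a (adj i (V x))) + Phi a (Q (V x)).

Let isoV x : inner (V x) (V x) = inner x x.
Proof. by rewrite adjP -comp_lfunE unitV.1 id_lfunE. Qed.

Let isoVadj x : inner (adj V x) (adj V x) = inner x x.
Proof. by rewrite -adjPr -comp_lfunE unitV.2 id_lfunE. Qed.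

Let M := \1%VF - (Q \o V \o Q)%VF.

(** The loop equation [w = Q V (i x + w)] reads [M w = Q V i x], and [M] may be singular. If
    [adj M z = 0], then [z = Q V^* z]; as [V^*] is isometric, [V^* z] has no component in [U], so
    [z] is orthogonal to [Q V i x]. *)
Let range_M x : Q (V (i x)) \in limg M.
Proof.
apply: mem_orth_limg => z; rewrite adjB adj_id !adj_comp adjQ.
rewrite add_lfunE opp_lfunE id_lfunE !comp_lfunE => /subr0_eq zE.
have Qz : Q z = z by rewrite zE QQ.
rewrite Qz in zE; have := split_norm (adj V z).
rewrite -zE isoVadj -[LHS]add0r => /addIr/esym/inner_eq0 iVz.
by rewrite adjP adjQ Qz adjP adjP iVz inner0r.
Qed.

Let W : 'Hom(subvs_of U, H) := (M^-1 \o Q \o V \o i)%VF.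

Let WE x : W x = Q (V (i x + Q (W x))).
Proof.
have : M (W x) = Q (V (i x)).
  by rewrite /W !comp_lfunE limg_lfunVK // range_M.
move: (W x) => w; rewrite add_lfunE opp_lfunE id_lfunE !comp_lfunE !lfunrD => <-.
by rewrite subrK.
Qed.

Let QW x : Q (W x) = W x. Proof. by rewrite WE QQ. Qed.

(* [Y x] is the output of [V] when its [Q]-component is fed back as input. *)
Let Y : 'End(subvs_of U) := (adj i \o V \o (i + W))%VF.

(** The output does not depend on the solution of the loop equation: the difference [u] of two
    solutions satisfies [Q V u = u], so by isometry [V u] has no component in [U]. *)
Let YE x w : Q w = w -> Q (V (i x + w)) = w -> Y x = adj i (V (i x + w)).
Proof.
move=> Qw Vw; rewrite /Y !comp_lfunE add_lfunE; pose u := W x - w.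
have uE : u = i x + W x - (i x + w) by rewrite opprD addrACA subrr add0r.
have WVx : Q (V (i x + W x)) = W x by rewrite [RHS]WE QW.
have Vu : Q (V u) = u by rewrite [in LHS]uE !lfunrB WVx Vw.
have : adj i (V u) = 0.
  have := split_norm (V u); rewrite Vu isoV -[LHS]add0r => /addIr/esym.
  exact: inner_eq0.
by rewrite uE !lfunrB => /subr0_eq.
Qed.

Lemma feedback_unitary :
  exists2 Y : 'End(subvs_of U), unitary_op Y &
    forall a, conj i Phi a = Ad Y (Om a).
Proof.
have isoY x : inner (Y x) (Y x) = inner x x.
  have WVx : Q (V (i x + W x)) = W x by rewrite [RHS]WE QW.
  rewrite (YE (QW x) WVx).
  have := split_norm (V (i x + W x)); rewrite isoV WVx.
  rewrite !(innerDl, innerDr) (innerC (W x) (i x)) -{1 2}QW !inner_iQ inner_isub.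
  by move=> ?; lra.
(* The fed-back component has the same norm in the input and the output of [V], which made [Y]
   isometric; polarization follows. *)
have YY : (adj Y \o Y)%VF = \1%VF.
  apply/subr0_eq/sym_psd_eq0; first by rewrite adjB adj_comp adjK adj_id.
  move=> x; rewrite add_lfunE opp_lfunE id_lfunE comp_lfunE innerBr -adjP isoY.
  exact: subrr.
have [|Y' [_ YY']] := @lfun_inj_surj _ _ Y.
  by move=> x Yx; apply: inner_eq0; rewrite -isoY Yx inner0r.
have adjYE : adj Y = Y'.
  by rewrite -[LHS]comp_lfun1r -YY' comp_lfunA YY comp_lfun1l.
exists Y; first by split; rewrite // adjYE.
move=> a; apply/lfunP => x; rewrite /Ad 2!comp_lfunE.
suff <- : Y (conj i Phi a x) = Om a (Y x).
  by rewrite -[RHS]comp_lfunE YY id_lfunE.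
have xE : i (conj i Phi a x) + Phi a (W x) = Phi a (i x + W x).
  by rewrite lfunrD isub_intertwine.
have WVx : Q (V (i x + W x)) = W x by rewrite [RHS]WE QW.
(* [Phi a (W x)] solves the loop equation for the input [conj i Phi a x]. *)
rewrite (@YE _ (Phi a (W x))).
- by rewrite xE VPhi lfunrD ii -Q_commute iQ addr0 -(YE (QW x) WVx).
- by rewrite Q_commute QW.
- by rewrite xE VPhi lfunrD Qi add0r -Q_commute QQ Q_commute WVx.
Qed.

End Feedback.

(** Extend [Om] by [Phi] and [T] by the identity on the complement of [U]. Rigidity of [Phi] gives a
    unitary on [H], and feedback turns it into one on [U]. *)
Lemma rigid_compression : rigid Phi -> rigid (conj i Phi).
Proof.
move=> rigPhi Om T ucpOm [S [ST TS]] TOm.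
have /ucpP[cpOm Om1] := ucpOm; have /ucpP[cpC C1] := ucp_compression.
pose Om' : {linear A -> 'End(H)} := conj (adj i) Om \+ conj Q Phi.
have Om'E a x : Om' a x = i (Om a (adj i x)) + Phi a (Q x).
  by rewrite /= add_lfunE !conjE adjK adjQ Q_commute QQ.
have ucpOm' : UCP Om'.
  apply/ucpP; split; first by apply: cpD; apply: cp_conj.
  apply/lfunP => x; rewrite Om'E Om1 Phi1 !id_lfunE iiP QE.
  by rewrite addrC subrK.
pose ext (X : 'End(subvs_of U)) : 'End(H) := (i \o X \o adj i)%VF + Q.
have extE X x : ext X x = i (X (adj i x)) + Q x.
  by rewrite add_lfunE !comp_lfunE.
have i_ext X x : adj i (ext X x) = X (adj i x) by rewrite extE lfunrD ii iQ addr0.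
have Q_ext X x : Q (ext X x) = Q x by rewrite extE lfunrD Qi QQ add0r.
have ext_comp X X' : (X \o X' = \1)%VF -> (ext X \o ext X' = \1)%VF.
  move=> XX'; apply/lfunP => x; rewrite comp_lfunE extE i_ext Q_ext.
  by rewrite -(comp_lfunE X) XX' !id_lfunE iiP QE addrC subrK.
have [||V [unitV PhiE]] := rigPhi Om' (ext T) ucpOm'.
- by exists (ext S); split; apply: ext_comp.
- have [c c0 TOm'] := domP cpC TOm; exists (c + 1) => n a h.
  have := TOm' n a (adj i \o h); have := cpC.2 n a (adj i \o h).
  have := cpPhi.2 n a (Q \o h).
  have -> : qf (conj (ext T) Om') a h =
            qf (conj T Om) a (adj i \o h) + qf Phi a (Q \o h).
    rewrite qf_conj qfD !qf_conj; congr (_ + _); apply: eq_qfr => j /=.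
      by rewrite i_ext.
    by rewrite Q_ext.
  by rewrite (qf_split a h); nra.
have [|Y unitY CE] := @feedback_unitary Om V unitV.
  move=> a x; rewrite -Om'E PhiE /Ad !comp_lfunE -(comp_lfunE V (adj V)).
  by rewrite unitV.2 id_lfunE.
by exists Y.
Qed.

Lemma irreducible_compression :
  (forall V, invariant Phi V -> (V <= U)%VS -> V = 0%VS \/ V = U) ->
  irreducible (conj i Phi).
Proof.
move=> minU V invV; have [||iV0|iVU] := minU (i @: V)%VS.
- move=> a _ /memv_imgP[x xV ->]; rewrite isub_intertwine memv_img //.
  exact: invV.
- by apply/subvP => _ /memv_imgP[x _ ->]; rewrite /i isubE subvsP.
- left; apply/eqP; rewrite -subv0; apply/subvP => x xV; rewrite memv0 -(ii x).
  have : i x \in (i @: V)%VS by apply: memv_img.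
  by rewrite iV0 memv0 => /eqP->; rewrite lfunr0.
- right; apply/eqP; rewrite eqEsubv subvf; apply/subvP => x _.
  have xU : i x \in U by rewrite /i isubE subvsP.
  have : i x \in (i @: V)%VS by rewrite iVU.
  by move=> /memv_imgP[y yV /(congr1 (adj i))]; rewrite !ii => ->.
Qed.

End Compression.

(** * Decomposition into irreducible maps *)

Section Decomposition.
Variables (R : realType) (A : realCStarAlgType R) (H : finHilbertType R).
Variables (Phi : {linear A -> 'End(H)}).
Hypothesis ucpPhi : UCP Phi.

Definition minimal_invariant (U : {vspace H}) :=
  invariant Phi U /\
  forall V, invariant Phi V -> (V <= U)%VS -> V = 0%VS \/ V = U.

Lemma exists_minimal_invariant (W : {vspace H}) : invariant Phi W -> W != 0%VS ->
  exists U, [/\ minimal_invariant U, (U <= W)%VS & U != 0%VS].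
Proof.
move=> invW W0.
pose Q k := `[< exists U, [/\ invariant Phi U, (U <= W)%VS, U != 0%VS & \dim U = k] >].
have exQ : exists k, Q k by exists (\dim W); apply/asboolP; exists W.
case: (ex_minnP exQ) => k /asboolP[U [invU UW U0 dimU]] mink.
exists U; split=> //; split=> // V invV VU.
have [->|V0] := eqVneq V 0%VS; [by left | right].
apply/eqP; rewrite eqEdim VU dimU; apply: mink; apply/asboolP; exists V; split=> //.
exact: subv_trans VU UW.
Qed.

Lemma minimal_invariant_decomposition (W : {vspace H}) : invariant Phi W ->
  exists k (Hs : 'I_k -> {vspace H}),
    [/\ forall i, minimal_invariant (Hs i),
        forall i j, i != j -> forall x y, x \in Hs i -> y \in Hs j -> inner x y = 0
      & (\sum_i Hs i)%VS = W].
Proof.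
have [n] := ubnP (\dim W); elim: n => // n IHn in W *; rewrite ltnS => dimW invW.
have [->|W0] := eqVneq W 0%VS.
  by exists 0%N, (fun=> 0%VS); split=> [[]|[]|] //; rewrite big_ord0.
have [U [minU UW U0]] := exists_minimal_invariant invW W0.
(* The orthogonal complement of [U] in [W]; it is invariant because the projection commutes with
   [Phi]. *)
pose W' := (W :&: lker (oproj U))%VS.
have PU x : x \in U -> oproj U x = x := @oproj_id _ _ U x.
have W'W : (W' <= W)%VS := capvSl _ _.
have [||k [Hs [minHs orthHs sumHs]]] := IHn W'.
- apply: leq_trans dimW; apply: (@dimv_lt _ _ _ _ (vpick U) W'W).
    by rewrite (subvP UW) // memv_pick.
  by rewrite memv_cap memv_ker PU ?memv_pick // vpick0 negb_and U0 orbT.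
- move=> a x; rewrite !memv_cap !memv_ker => /andP[xW /eqP Px].
  by rewrite invW //= (oproj_commute ucpPhi minU.1) Px lfunr0.
have HsW' i : (Hs i <= W')%VS by rewrite -sumHs (sumv_sup i).
have orthU x y : x \in U -> y \in W' -> inner x y = 0.
  move=> xU; rewrite memv_cap memv_ker => /andP[_ /eqP Py].
  by rewrite -(PU x xU) adjP adj_oproj Py inner0r.
exists k.+1, (fun i => oapp Hs U (unlift ord0 i)); split.
- by move=> i; case: unliftP => [j|] _ /=; [apply: minHs | ].
- move=> i j; case: unliftP => [i'|] ->; case: unliftP => [j'|] -> //=.
  + by rewrite (inj_eq lift_inj) => /orthHs.
  + by move=> _ x y /(subvP (HsW' _)) xW' yU; rewrite innerC orthU.
  + by move=> _ x y xU /(subvP (HsW' _)); apply: orthU.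
rewrite big_ord_recl unlift_none /=.
under eq_bigr => i _ do rewrite liftK /=.
rewrite sumHs; apply/eqP; rewrite eqEsubv subv_add UW W'W /=.
apply/subvP => x xW; have -> : x = oproj U x + (x - oproj U x) by rewrite addrC subrK.
rewrite memv_add ?mem_oproj // memv_cap memv_ker lfunrB (PU (oproj U x)) ?mem_oproj //.
by rewrite subrr eqxx andbT rpredB // (subvP UW) ?mem_oproj.
Qed.

End Decomposition.

Theorem theorem3p18 (R : realType) (A : realCStarAlgType R)
    (H : finHilbertType R) (Phi : {linear A -> 'End(H)}) :
  cstar_extreme Phi ->
  exists (k : nat) (Hs : 'I_k -> {vspace H})
         (Phis : forall i : 'I_k, {linear A -> 'End(subvs_of (Hs i))}),
    (forall i, UCP (Phis i)) /\
    (forall i, pure (Phis i)) /\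
    orthogonal_decomposition Hs /\
    unitarily_equivalent Phi (direct_sum Phis).
Proof.
move=> extPhi; have ucpPhi := extPhi.1; have rigPhi := cstar_extreme_rigid extPhi.
have [|k [Hs [minHs orthHs sumHs]]] :=
  @minimal_invariant_decomposition _ _ _ Phi ucpPhi fullv.
  by move=> a x _; apply: memvf.
pose Phis i : {linear A -> 'End(subvs_of (Hs i))} := conj (isub (Hs i)) Phi.
have ucpPhis i : UCP (Phis i) := ucp_compression (Hs i) ucpPhi.
exists k, Hs, Phis; split=> //; split.
  move=> i; have [invHs minHsi] := minHs i.
  apply: irreducible_rigid_pure => //.
    exact: (rigid_compression ucpPhi).
  exact: irreducible_compression.
have orth : orthogonal_decomposition Hs by split.
(* The summands are compressions to reducing subspaces of [H] itself, so their direct sum equals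
   [Phi]. *)
split=> //; exists \1%VF; split.
  by rewrite /unitary_op adj_id comp_lfun1l.
move=> a; rewrite -[RHS]/(conj \1%VF Phi a) conj_id; apply/lfunP => x.
have /memv_sumP[v vHs ->] : x \in (\sum_(i < k) Hs i)%VS by rewrite sumHs memvf.
rewrite !lfunr_sum; apply: eq_bigr => i _.
rewrite -(vsprojK (vHs i isT)) direct_sumE //.
by rewrite -!isubE (isub_intertwine (minHs i).1).
Qed.
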